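(* (Up-down horizontal $\imath$Pieri rule.) For every integer $r\ge 1$ and every partition $\mu$, the following identity holds in $\Lambda_{t,\theta}$: $$V^{\imath}_\mu\cdot v_r=\sum_{a+b=r}\ \sum_{\lambda\stackrel{a}{\rightarrow}\xi}\ \sum_{\mu\stackrel{b}{\rightarrow}\xi}\theta^a\,\varphi_{\xi/\lambda}(t)\,\psi_{\xi/\mu}(t)\;V^{\imath}_\lambda+\sum_{a+b=r}\ \sum_{i=1}^{\min(a,b)}\ \sum_{\lambda\stackrel{a-i}{\rightarrow}\xi}\ \sum_{\mu\stackrel{b-i}{\rightarrow}\xi}\theta^a\,(t^i-t^{i-1})\,\varphi_{\xi/\lambda}(t)\,\psi_{\xi/\mu}(t)\;V^{\imath}_\lambda ,$$ where $a,b$ run over non-negative integers with $a+b=r$, and the inner double sums run over all pairs of partitions $(\xi,\lambda)$ satisfying the two indicated horizontal-strip conditions.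
   Context: Let $t,\theta$ be indeterminates and $\Lambda_{t,\theta}=\mathbb{Q}(t)[\theta][v_1,v_2,\ldots]$ the polynomial ring in commuting variables $v_r$ ($r\ge1$). Set $v_0=1$, $v_a=0$ for $a<0$, and $v_\alpha=v_{\alpha_1}v_{\alpha_2}\cdots$ for an integer sequence $\alpha=(\alpha_1,\alpha_2,\ldots)$ with finitely many nonzero entries. For $1\le i<j$ the raising operator $R_{ij}$ sends $\alpha$ to $(\ldots,\alpha_i+1,\ldots,\alpha_j-1,\ldots)$ and the lowering operator $L_{ij}$ sends $\alpha$ to $(\ldots,\alpha_i-1,\ldots,\alpha_j-1,\ldots)$; they act by $R_{ij}v_\alpha=v_{R_{ij}\alpha}$, $L_{ij}v_\alpha=v_{L_{ij}\alpha}$ (products of operators are applied to the index sequence first, and only then is $v$ evaluated; all these operators commute). For an integer vector $\alpha$ define $$V^{\imath}_\alpha=\prod_{1\le i<j}\frac{1-\theta L_{ij}}{1-\theta tL_{ij}}\,\frac{1-R_{ij}}{1-tR_{ij}}\;v_\alpha,$$ where $\frac{1-u}{1-tu}$ is expanded as $1+(1-t^{-1})\sum_{s\ge1}t^su^s$; only finitely many terms are nonzero. For partitions, $\nu\le\mu$ means $\nu_i\le\mu_i$ for all $i$; $\nu\stackrel{a}{\rightarrow}\mu$ means $\nu\le\mu$ and $\mu-\nu$ is a horizontal $a$-strip ($a$ boxes, at most one in each column). $\mu'$ denotes the conjugate partition and $m_i(\mu)$ the number of parts of $\mu$ equal to $i$. For a horizontal strip $\sigma=\lambda-\nu$ put $\sigma_i'=\lambda_i'-\nu_i'\in\{0,1\}$;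 let $I_{\lambda-\nu}$ be the set of $i\ge1$ with $\sigma_i'=1,\ \sigma_{i+1}'=0$, and $J_{\lambda-\nu}$ the set of $i\ge 1$ with $\sigma_i'=0,\ \sigma'_{i+1}=1$. Define $$\varphi_{\lambda/\nu}(t)=\prod_{i\in I_{\lambda-\nu}}(1-t^{m_i(\lambda)}),\qquad \psi_{\lambda/\nu}(t)=\prod_{j\in J_{\lambda-\nu}}(1-t^{m_j(\nu)}).$$ *)

(* Defs.v *)
From HB Require Import structures.
From mathcomp Require Import all_boot all_order all_algebra finmap.
From mathcomp Require Import boolp classical_sets cardinality fsbigop.
From mathcomp Require Import monalg.

Set Implicit Arguments.
Unset Strict Implicit.
Unset Printing Implicit Defensive.

Import GRing.Theory.

Local Open Scope classical_set_scope.
Local Open Scope ring_scope.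

(* All sums `\sum_(x \in A)` and products `\big[*%R/1]_(x \in A)` over a
   classical set A are fsbigop's: they equal the expected finite sum (product)
   when finitely many terms differ from 0 (from 1), which holds at every use
   below. *)

Notation Qt := {fraction {poly rat}}.
Notation Qt_theta := {poly Qt}.
Notation Lambda := {malg Qt_theta[{cmonom nat}]}.

Definition t : Qt := tofrac ('X : {poly rat}).
Definition theta : Qt_theta := 'X.

(* The generator of index r of the monoid algebra is v_(r+1). *)
Definition v (a : int) : Lambda :=
  match a with
  | Posz 0 => 1
  | Posz r.+1 => << ucm r >>
  | Negz _ => 0
  end.

(* Finitely supported integer sequences, written additively: << k >> is the
   k-th unit sequence and alpha@_k the entry of index k. Indices start at 0. *)
Notation iseq := {malg int[nat]}.

Definition vseq (alpha : iseq) : Lambda :=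
  \prod_(k <- msupp alpha) v (alpha@_k).

Definition raise_op (p : nat * nat) (alpha : iseq) : iseq :=
  alpha + << p.1 >> - << p.2 >>.

Definition lower_op (p : nat * nat) (alpha : iseq) : iseq :=
  alpha - << p.1 >> - << p.2 >>.

(* A finitely supported family e of exponents, indexed by pairs (i, j),
   stands for the monomial prod_(i, j) T_ij ^ e_ij in commuting operators. *)
Notation opmon := {fsfun (nat * nat) -> nat with 0%N}.

Definition on_increasing_pairs (e : opmon) : Prop :=
  forall p, p \in finsupp e -> (p.1 < p.2)%N.

Definition act_mon (T : nat * nat -> iseq -> iseq) (e : opmon) (alpha : iseq) :
    iseq :=
  foldr (fun p => iter (e p) (T p)) alpha (finsupp e).

(* The coefficient of u^s in (1 - u) / (1 - t u). *)
Definition geom_coef (s : nat) : Qt :=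
  if s == 0%N then 1 else (1 - t^-1) * t ^+ s.

(* The coefficients of prod L_ij ^ e_ij and of prod R_ij ^ e_ij in
   prod (1 - theta L_ij) / (1 - theta t L_ij) and
   prod (1 - R_ij) / (1 - t R_ij). *)
Definition lower_coef (e : opmon) : Qt_theta :=
  \prod_(p <- finsupp e) ((geom_coef (e p))%:P * theta ^+ e p).

Definition raise_coef (e : opmon) : Qt_theta :=
  \prod_(p <- finsupp e) (geom_coef (e p))%:P.

(* The index d = (e, f) gives the term of prod L_ij ^ e_ij * prod R_ij ^ f_ij;
   this operator monomial acts on alpha before v is evaluated. The terms reach
   positions beyond the support of alpha, but there they contribute 0: the
   last position touched is only ever lowered. *)
Definition Vi (alpha : iseq) : Lambda :=
  \sum_(d \in [set d : opmon * opmon |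
                on_increasing_pairs d.1 /\ on_increasing_pairs d.2])
     (lower_coef d.1 * raise_coef d.2) *:
       vseq (act_mon lower_op d.1 (act_mon raise_op d.2 alpha)).

Definition is_part (l : seq nat) : bool := sorted geq l && (0 \notin l)%N.

Definition iseq_of_part (l : seq nat) : iseq :=
  \sum_(k < size l) << (nth 0%N l k)%:Z *g (k : nat) >>.

Definition conj_part (l : seq nat) (i : nat) : nat := count (leq i) l.

Definition mult_part (l : seq nat) (i : nat) : nat := count_mem i l.

Definition part_le (n l : seq nat) : Prop :=
  forall k, (nth 0 n k <= nth 0 l k)%N.

Definition strip_col (l n : seq nat) (i : nat) : int :=
  (conj_part l i)%:Z - (conj_part n i)%:Z.

Definition hstrip (a : nat) (n l : seq nat) : Prop :=
  [/\ part_le n l,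
      sumn l = (sumn n + a)%N &
      forall i, (1 <= i)%N -> (strip_col l n i <= 1)%R].

Definition strip_I (l n : seq nat) : set nat :=
  [set i | [/\ (1 <= i)%N, strip_col l n i = 1 & strip_col l n i.+1 = 0]].

Definition strip_J (l n : seq nat) : set nat :=
  [set i | [/\ (1 <= i)%N, strip_col l n i = 0 & strip_col l n i.+1 = 1]].

Definition phi (l n : seq nat) : Qt :=
  \big[*%R/1]_(i \in strip_I l n) (1 - t ^+ mult_part l i).

Definition psi (l n : seq nat) : Qt :=
  \big[*%R/1]_(j \in strip_J l n) (1 - t ^+ mult_part n j).

(* The pairs p = (xi, lambda) with lambda -a-> xi and mu -b-> xi. *)
Definition updown (mu : seq nat) (a b : nat) : set (seq nat * seq nat) :=
  [set p | [/\ is_part p.1, is_part p.2, hstrip a p.2 p.1 & hstrip b mu p.1]].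

(* Main.v *)
(* Write F(u) = (1 - u) / (1 - t u).  Let a(w) and ah(w) be the algebra
   homomorphisms with v(z) |-> v(z) / F(z w) and v(z) |-> F(z w) v(z), where
   v(z) = sum_n v_n z^n; they are inverse to each other.  With
   Z(w) = v(w) ah(theta w) and B(z) = Z(z) ah(1/z), the element V_alpha is
   B_(alpha_1) ... B_(alpha_n) applied to 1, and multiplication by v(w) is
   Z(w) a(theta w).  Since Z_b a_k = sum_i h_i a_(k-i) Z_(b-i), with h_i the
   coefficients of F, the theorem follows from
     a_k V_xi = sum_lambda phi_(xi/lambda) V_lambda   (k-strips xi - lambda),
     Z_b V_mu = sum_xi psi_(xi/mu) V_xi               (b-strips xi - mu).
   Put C_m(w) = sum_(k >= 0) w^k B_(m-k) a(w).  The exchange relation of the B_n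
   gives C_(m-1) B_m = t B_m C_(m-1), hence
     a B_m^s   = B_m^s a + w (1 - t^s) B_m^(s-1) C_(m-1),
     C_m B_m^s = B_m^(s+1) a + w B_m^s C_(m-1).
   Read column by column on V_xi = B_M^(m_M) ... B_1^(m_1) 1, a and C record
   whether the removed strip meets the previous column, which yields phi; and
   psi comes from the complementary strips, because Z(w) = B(w) a(1/w). *)
From HB Require Import structures.
Require Import Defs.
From mathcomp Require Import all_boot all_order all_algebra finmap.
From mathcomp Require Import boolp classical_sets cardinality fsbigop.
From mathcomp Require Import monalg.
From mathcomp Require Import zify ring.
Set Implicit Arguments.
Unset Strict Implicit.
Unset Printing Implicit Defensive.

Import Order.TTheory GRing.Theory Num.Theory.
Local Open Scope ring_scope.

(** * Sums *)

(** The overview takes for granted that V_alpha is B_(alpha_1) ... B_(alpha_n) 1. This is a normal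
    ordering: moving the factor ah(1/z) of row k past the B of a row j > k produces F(R_kj), moving
    ah(theta z) past it produces F(theta L_kj), and both factors fix 1, so that v_alpha remains.
    These exchanges are available only as two-term relations (1 - t u) x = (1 - u) y, with u a shift
    of indices; they can be solved for x because far along the shift everything vanishes. The
    defining sum has unboundedly many exponents and positions. A term survives only if all its
    entries stay non-negative, and non-negative weights that grow along the positions cannot
    increase under R_ij or L_ij, which bounds both. The relation C_(m-1) B_m = t B_m C_(m-1) comes
    from summing an antisymmetric exchange relation over an antidiagonal. This yields X = -X, whence
    the assumption [A_char]. *)

Section TriangularSums.
Variable V : zmodType.
Implicit Type F : nat -> nat -> V.

(** Grouping by n = k + i + 1 rather than k + i gives both outer sums the range of [Cop]; the
    truncated predecessor is harmless because the group n = 0 is empty. *)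
Lemma sum_triangle F r :
  \sum_(k < r.+1) \sum_(i < r - k) F k i =
  \sum_(n < r.+1) \sum_(k < n) F k (n.-1 - k)%N.
Proof.
elim: r => [|r IHr]; first by rewrite !big_ord1 !big_ord0.
rewrite [RHS]big_ord_recr -IHr big_ord_recr /= subnn big_ord0 addr0 -big_split.
by apply: eq_bigr => k _; rewrite subSn -1?ltnS // big_ord_recr.
Qed.

Lemma sum_antidiagonal F r :
  \sum_(k < r) \sum_(i < r - k) F k i =
  \sum_(p < r) \sum_(k < p.+1) F k (p - k)%N.
Proof.
have := sum_triangle F r.
rewrite big_ord_recr /= subnn big_ord0 addr0 => ->.
by rewrite big_ord_recl big_ord0 add0r.
Qed.

Lemma sum_square F N : (forall k i, (N <= k)%N || (N <= i)%N -> F k i = 0) ->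
  \sum_(k < N) \sum_(i < N) F k i =
  \sum_(p < N + N) \sum_(k < p.+1) F k (p - k)%N.
Proof.
move=> F0; rewrite -sum_antidiagonal [RHS]big_split_ord /=.
rewrite [X in _ + X]big1 ?addr0 => [|k _]; last first.
  by rewrite big1 // => i _; rewrite F0 // leq_addr.
apply: eq_bigr => k _; rewrite (_ : N + N - k = N + (N - k))%N; last first.
  by rewrite addnBA // ltnW.
rewrite [RHS]big_split_ord /= [X in _ + X]big1 ?addr0 // => i _.
by rewrite F0 // leq_addr orbT.
Qed.

End TriangularSums.

(** * Operator series applied to the coefficients of a polynomial *)

Section PolySum.
Variables (R : comNzRingType) (A : comAlgType R).
Implicit Types (F G : nat -> {linear A -> A}) (p q : {poly A}).

(** With p = [ah x] this is the operator sum_j F_j ah_j at x; even for a product of series in z and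
    1/z it is finite, since [ah x] is a polynomial. *)
Definition psum F p : A := \sum_(j < size p) F j p`_j.

Lemma psumE F p N : (size p <= N)%N -> psum F p = \sum_(j < N) F j p`_j.
Proof.
move=> leN; rewrite /psum -!(big_mkord xpredT (fun j => F j p`_j)).
rewrite [RHS](big_cat_nat _ leN) //= [X in _ + X]big_nat.
rewrite [X in _ + X]big1 ?addr0 // => j.
by case/andP=> lej _; rewrite nth_default ?linear0.
Qed.

Lemma eq_psum F G p : (forall j x, F j x = G j x) -> psum F p = psum G p.
Proof. by move=> eqFG; apply: eq_bigr => j _. Qed.

Lemma psumD F p q : psum F (p + q) = psum F p + psum F q.
Proof.
pose N := maxn (size p) (size q).
rewrite !(@psumE _ _ N) ?leq_maxl ?leq_maxr ?size_polyD //.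
by rewrite -big_split; apply: eq_bigr => j _; rewrite coefD linearD.
Qed.

Lemma psumZ F c p : psum F (c%:A *: p) = c *: psum F p.
Proof.
rewrite (@psumE _ _ (size p)) ?size_scale_leq // /psum scaler_sumr.
by apply: eq_bigr => j _; rewrite coefZ mulr_algl linearZ.
Qed.

Lemma psum0 F : psum F 0 = 0.
Proof. by rewrite /psum size_poly0 big_ord0. Qed.

Lemma psumN F p : psum F (- p) = - psum F p.
Proof. by apply/eqP; rewrite -addr_eq0 -psumD addNr psum0. Qed.

Lemma psumB F p q : psum F (p - q) = psum F p - psum F q.
Proof. by rewrite psumD psumN. Qed.

Lemma psumXM F p : psum F ('X * p) = psum (fun j => F j.+1) p.
Proof.
rewrite (@psumE _ _ (size p).+1); last first.
  by rewrite mulrC (leq_trans (size_polyMleq _ _)) // size_polyX addn2.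
rewrite big_ord_recl coefXM /= linear0 add0r /psum.
by apply: eq_bigr => j _; rewrite coefXM.
Qed.

Lemma psumC F x : psum F x%:P = F 0%N x.
Proof. by rewrite (@psumE _ _ 1) ?size_polyC_leq1 // big_ord1 coefC. Qed.

Lemma psum_map F (L : {linear A -> A}) p :
  psum F (map_poly L p) = psum (fun j => F j \o L) p.
Proof.
rewrite (@psumE _ _ (size p)) ?size_poly // /psum.
by apply: eq_bigr => j _; rewrite coef_map.
Qed.

End PolySum.

(** With 'X as w, this is the coefficient of z^n in (1 - p z w) S(v(z)) = (1 - q z w) v(z). The pair
    (p, q) is (1, t) for a and (t, 1) for ah. *)
Definition shift_rel (R : comNzRingType) (A : comAlgType R) (v : int -> A)
    (p q : R) (S : A -> {poly A}) :=
  forall n, S (v n) - p%:A *: ('X * S (v (n - 1))) =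
    (v n)%:P - q%:A *: ('X * (v (n - 1))%:P).

(** * Vertex operators *)

(* A partition whose parts are at most M is coded by its multiplicities
   [:: m_M; ...; m_1]; a 0-1 word [:: s_M; ...; s_1] is a horizontal strip with
   s_i boxes in column i, and eps is the number of its boxes in column M + 1. *)
Fixpoint strip_remove (eps : bool) (ms : seq nat) (s : seq bool) : seq nat :=
  if ms is m :: ms' then
    if s is b :: s' then (m + eps - b)%N :: strip_remove b ms' s' else [::]
  else [::].

(** For m = 0 the factor 1 - t^m is 0, so a word that would remove a missing box has weight 0 and
    the truncated subtraction in [strip_remove] does no harm. *)
Fixpoint strip_weight (R : pzRingType) (t : R) (eps : bool) (ms : seq nat)
    (s : seq bool) : R :=
  if ms is m :: ms' then
    if s is b :: s' then
      (if b && ~~ eps then 1 - t ^+ m else 1) * strip_weight t b ms' s'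
    else 1
  else 1.

Fixpoint bit_words (n : nat) : seq (seq bool) :=
  if n is n'.+1 then
    [seq false :: s | s <- bit_words n'] ++ [seq true :: s | s <- bit_words n']
  else [:: [::]].

Lemma mem_bit_words n s : (s \in bit_words n) = (size s == n).
Proof.
elim: n s => [|n IHn] s; first by rewrite inE size_eq0.
rewrite mem_cat; case: s => [|b s] /=.
  by rewrite eqE; apply/negbTE/norP; split; apply/mapP => [[]].
have inj c : injective (cons c : seq bool -> _) by move=> x y [].
rewrite eqSS -IHn; case: b.
  rewrite (mem_map (inj true)) orbC; case: (s \in _) => //=.
  by apply/mapP => [[]].
rewrite (mem_map (inj false)); case: (s \in _) => //=.
by apply/mapP => [[]].
Qed.

Lemma bit_words_uniq n : uniq (bit_words n).
Proof.
have inj c : injective (cons c : seq bool -> _) by move=> x y [].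
elim: n => //= n IHn; rewrite cat_uniq !map_inj_uniq ?IHn //= andbT.
by apply/hasPn => _ /mapP[s _ ->]; apply/mapP => [[]].
Qed.

Lemma size_strip_remove eps ms s : size s = size ms ->
  size (strip_remove eps ms s) = size ms.
Proof. by elim: ms eps s => [|m ms IHms] eps [|b s] //= [/IHms->]. Qed.

Section Operators.
Variables (R : comNzRingType) (A : comAlgType R).
Variables (t theta : R) (v : int -> A) (a ah : {rmorphism A -> {poly A}}).
Hypothesis aZ : forall c x, a (c *: x) = c%:A *: a x.
Hypothesis ahZ : forall c x, ah (c *: x) = c%:A *: ah x.
Hypothesis v0 : v 0 = 1.
Hypothesis v_neg : forall n : int, (n < 0)%R -> v n = 0.
Hypothesis a_v : shift_rel v 1 t a.
Hypothesis ah_v : shift_rel v t 1 ah.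
Hypothesis a_ahC : forall x i j, (a (ah x)`_i)`_j = (ah (a x)`_j)`_i.
Hypothesis ah_ahC : forall x i j, (ah (ah x)`_i)`_j = (ah (ah x)`_j)`_i.
Hypothesis a0 : forall x, (a x)`_0 = x.
Hypothesis ah0 : forall x, (ah x)`_0 = x.
Hypothesis A_char : forall x : A, x = - x -> x = 0.
(** The coefficients of F, given by a recurrence because t need not be invertible in R. *)
Variable g : nat -> R.
Hypothesis g_0 : g 0 = 1.
Hypothesis g_1 : g 1 = t - 1.
Hypothesis g_SS : forall k, g k.+2 = t * g k.+1.
Hypothesis ah_aK : forall x k,
  \sum_(i < k.+1) (ah (a x)`_(k - i))`_i = if k == 0%N then x else 0.

Definition Zterm (n : int) (j : nat) (x : A) : A :=
  theta ^+ j *: (v (n - j%:Z) * x).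

Fact Zterm_is_linear n j : linear (Zterm n j).
Proof.
by move=> c x y; rewrite /Zterm mulrDr -scalerAr scalerDr !scalerA [_ ^+ _ * c]mulrC.
Qed.
HB.instance Definition _ n j :=
  GRing.isLinear.Build R A A _ (Zterm n j) (Zterm_is_linear n j).

(* Z(w) = v(w) ah(theta w) and B(z) = Z(z) ah(1/z), as generating functions. *)
Definition Zop (n : int) (x : A) : A := psum (Zterm n) (ah x).

Fact Zop_is_linear n : linear (Zop n).
Proof. by move=> c x y; rewrite /Zop rmorphD ahZ psumD psumZ. Qed.
HB.instance Definition _ n :=
  GRing.isLinear.Build R A A _ (Zop n) (Zop_is_linear n).

Definition Bop (n : int) (x : A) : A := psum (fun l => Zop (n + l%:Z)) (ah x).

Fact Bop_is_linear n : linear (Bop n).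
Proof. by move=> c x y; rewrite /Bop rmorphD ahZ psumD psumZ. Qed.
HB.instance Definition _ n :=
  GRing.isLinear.Build R A A _ (Bop n) (Bop_is_linear n).

(* (1 - p z w) S(w) T(z) = (1 - q z w) T(z) S(w), with S(w) = sum_k S_k w^k and
   T(z) = sum_n T_n z^n. *)
Definition two_term (p q : R) (S : A -> {poly A}) (T : int -> {linear A -> A}) :=
  forall n x, S (T n x) - p%:A *: ('X * S (T (n - 1) x)) =
    map_poly (T n) (S x) - q%:A *: ('X * map_poly (T (n - 1)) (S x)).

Section TwoTerm.
Variables (p q : R) (S : {rmorphism A -> {poly A}}).
Hypothesis SZ : forall c x, S (c *: x) = c%:A *: S x.
Hypothesis S_v : shift_rel v p q S.
Hypothesis S_ahC : forall x i j, (S (ah x)`_i)`_j = (ah (S x)`_j)`_i.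

(** S commutes with each ah_j, so an ah_j that kills x kills every coefficient of S x: one range of
    summation serves all of them. *)
Lemma size_ahS x k : (size (ah (S x)`_k)%R <= size (ah x))%N.
Proof.
by apply/leq_sizeP => j lej; rewrite -S_ahC [(ah x)`_j]nth_default ?rmorph0 ?coef0.
Qed.

(** Since S commutes with ah, a relation between the summands survives precomposition with ah_j and
    summation over j. It is used twice, to pass from v to Z and from Z to B. *)
Lemma two_term_psum (T T' : int -> nat -> {linear A -> A}) :
  (forall n j x, S (T n j x) - p%:A *: ('X * S (T (n - 1) j x)) =
    map_poly (T' n j) (S x) - q%:A *: ('X * map_poly (T' (n - 1) j) (S x))) ->
  forall n x, S (psum (T n) (ah x)) - p%:A *: ('X * S (psum (T (n - 1)) (ah x)))
  = map_poly (fun y => psum (T' n) (ah y)) (S x)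
    - q%:A *: ('X * map_poly (fun y => psum (T' (n - 1)) (ah y)) (S x)).
Proof.
move=> TT n x; pose N := size (ah x).
have mapE m : map_poly (fun y => psum (T' m) (ah y)) (S x) =
   \sum_(j < N) map_poly (T' m j) (S (ah x)`_j).
  apply/polyP => k; rewrite coef_map_id0 ?rmorph0 ?psum0 //.
  rewrite (psumE _ (size_ahS x k)) coef_sum; apply: eq_bigr => j _.
  by rewrite coef_map S_ahC.
rewrite !mapE /psum -/N !rmorph_sum !mulr_sumr !scaler_sumr -!sumrB.
by apply: eq_bigr => j _; apply: TT.
Qed.

Lemma two_term_Z : two_term p q S Zop.
Proof.
move=> n x; apply: two_term_psum => {n x} m j x.
rewrite /= /Zterm !SZ !rmorphM /= (_ : m - 1 - j%:Z = m - j%:Z - 1); last by lia.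
have mapE i : map_poly (fun y => theta ^+ j *: (v i * y)) (S x) =
    (theta ^+ j)%:A *: ((v i)%:P * S x).
  apply/polyP => k; rewrite coef_map_id0 ?mulr0 ?scaler0 //.
  by rewrite coefZ coefCM mulr_algl.
rewrite /Zterm in mapE *; rewrite !mapE.
set m' := m - j%:Z; set P := S x; set c := (theta ^+ j)%:A.
transitivity (c%:P * (S (v m') - p%:A *: ('X * S (v (m' - 1)))) * P).
  by rewrite -!mul_polyC; ring.
by rewrite S_v -!mul_polyC; ring.
Qed.

Lemma two_term_B : two_term p q S Bop.
Proof.
move=> n x; rewrite /Bop /=.
apply: (two_term_psum (T := fun m l => Zop (m + l%:Z))
  (T' := fun m l => Zop (m + l%:Z))).
by move=> {n x} m j x; rewrite (_ : m - 1 + j%:Z = m + j%:Z - 1) ?two_term_Z //; lia.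
Qed.

End TwoTerm.

(** * Commutation of the Z_n and exchange relation of the B_n *)

Lemma Zop_neg n x : n < 0 -> Zop n x = 0.
Proof.
move=> n_lt0; rewrite /Zop /psum big1 // => j _.
by rewrite /= /Zterm v_neg ?mul0r ?scaler0 //; lia.
Qed.

(** Only the factor ah of Z meets v(w), and ah(theta z) multiplies v(w) by F(theta z w). *)
Lemma Zop_vM (x n : int) y :
  Zop x (v n * y) - (t * theta) *: Zop (x - 1) (v (n - 1) * y) =
  v n * Zop x y - theta *: (v (n - 1) * Zop (x - 1) y).
Proof.
have vpsum m k z : psum (Zterm m) (k%:P * z) = k * psum (Zterm m) z.
  rewrite (@psumE _ _ _ _ (size z)); last first.
    by rewrite mul_polyC size_scale_leq.
  rewrite /psum mulr_sumr; apply: eq_bigr => j _.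
  by rewrite coefCM /= /Zterm -scalerAr !mulrA [k * _]mulrC.
have shift m z : theta *: psum (Zterm (m - 1)) z = psum (Zterm m) ('X * z).
  rewrite psumXM /psum scaler_sumr; apply: eq_bigr => j _.
  by rewrite /= /Zterm scalerA -exprS (_ : m - 1 - j%:Z = m - j.+1%:Z) //; lia.
rewrite /Zop -vpsum mulrC -scalerA -vpsum shift -psumZ.
rewrite shift -!psumB; congr (psum _ _); rewrite !rmorphM /=.
transitivity ((ah (v n) - t%:A *: ('X * ah (v (n - 1)))) * ah y).
  by rewrite -!mul_polyC; ring.
by rewrite ah_v !scale1r; ring.
Qed.

(** [U] is the normally ordered product of two Z's, symmetric because the v's commute and the ah's
    commute. [W] differs from it by F(theta z w), again symmetric in z and w. Thus W(x, y) is
    determined by [U] and W(x - 1, y - 1), and the recursion ends at x < 0, where Z_x = 0. *)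
Lemma ZopC x y f : Zop x (Zop y f) = Zop y (Zop x f).
Proof.
pose W x y := Zop x (Zop y f).
pose U x y := psum (fun j => Zterm y j \o Zop x) (ah f).
have UC m n : U m n = U n m.
  rewrite /U /psum /= /Zterm /=.
  transitivity (\sum_(j < size (ah f)) \sum_(i < size (ah f))
     theta ^+ (i + j) *: (v (n - j%:Z) * v (m - i%:Z) * (ah (ah f)`_j)`_i)).
    apply: eq_bigr => j _; rewrite /Zop (psumE _ (size_ahS ah_ahC f j)).
    rewrite mulr_sumr scaler_sumr; apply: eq_bigr => i _.
    by rewrite /= /Zterm -scalerAr scalerA mulrA -exprD addnC.
  rewrite exchange_big /=; apply: eq_bigr => j _.
  rewrite /Zop (psumE _ (size_ahS ah_ahC f j)) mulr_sumr scaler_sumr.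
  apply: eq_bigr => i _.
  by rewrite /= /Zterm -scalerAr scalerA mulrA -exprD ah_ahC [v _ * v _]mulrC.
have WU m n : W m n - (t * theta) *: W (m - 1) (n - 1) =
    U m n - theta *: U (m - 1) (n - 1).
  rewrite /W /U [Zop n f]/Zop [Zop (n - 1) f]/Zop /psum.
  rewrite (linear_sum (Zop m)) (linear_sum (Zop (m - 1))) !scaler_sumr -!sumrB.
  apply: eq_bigr => j _ /=; rewrite /Zterm !linearZ /=.
  rewrite !scalerA ![_ * theta ^+ j]mulrC -!scalerA -!scalerDr !scalerN [t *: _]scalerA.
  congr (_ *: _).
  by rewrite (_ : n - 1 - j%:Z = n - j%:Z - 1) ?Zop_vM //; lia.
rewrite -[LHS]/(W x y) -[RHS]/(W y x).
have [k] : {k : nat | x < k%:Z} by exists (`|x|.+1)%N; lia.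
elim: k x y => [|k IHk] x y lt_xk.
  by rewrite /W (Zop_neg f lt_xk) linear0 (Zop_neg _ lt_xk).
have eqW : W (x - 1) (y - 1) = W (y - 1) (x - 1) by apply: IHk; lia.
apply: (addIr (- ((t * theta) *: W (x - 1) (y - 1)))).
by rewrite WU UC [U (x - 1) _]UC -WU eqW.
Qed.

(* E(x, y) is the product B_x B_y without the factor (1 - w/z) / (1 - t w/z). *)
Definition Eop (x y : int) f := psum (fun l => Zop (x + l%:Z) \o Bop y) (ah f).

Lemma EopC x y f : Eop x y f = Eop y x f.
Proof.
have Esum m n : Eop m n f = \sum_(l < size (ah f)) \sum_(k < size (ah f))
    Zop (m + l%:Z) (Zop (n + k%:Z) (ah (ah f)`_l)`_k).
  rewrite /Eop /psum; apply: eq_bigr => l _ /=.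
  by rewrite /Bop (psumE _ (size_ahS ah_ahC f l)) linear_sum.
rewrite !Esum exchange_big /=; apply: eq_bigr => l _; apply: eq_bigr => k _.
by rewrite ZopC ah_ahC.
Qed.

(** Moving ah(1/z) past B(w) gives (1 - t w/z) B(z) B(w) = (1 - w/z) E(z, w). *)
Lemma Bop_exchange x y f :
  Bop (x - 1) (Bop y f) - t *: Bop x (Bop (y - 1) f) =
  Eop (x - 1) y f - Eop x (y - 1) f.
Proof.
have shift p : psum (fun l => Zop (x + l%:Z)) p =
    psum (fun l => Zop (x - 1 + l%:Z)) ('X * p).
  rewrite psumXM; apply: eq_psum => l z.
  by rewrite (_ : x - 1 + l.+1%:Z = x + l%:Z) //; lia.
rewrite {1 3}/Bop shift -psumZ -psumB (two_term_B ahZ ah_v ah_ahC).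
by rewrite !scale1r psumB -shift !psum_map.
Qed.

Lemma Bop_antisym x y f :
  Bop (x - 1) (Bop y f) - t *: Bop x (Bop (y - 1) f) =
  - (Bop (y - 1) (Bop x f) - t *: Bop y (Bop (x - 1) f)).
Proof. by rewrite !Bop_exchange opprB EopC [Eop x _ f]EopC. Qed.

(** * The operators a(w) and C_m(w) on powers of B_m *)

Lemma a_BopS m f k : (a (Bop m f))`_k.+1 = (a (Bop (m - 1) f))`_k
  + Bop m (a f)`_k.+1 - t *: Bop (m - 1) (a f)`_k.
Proof.
have := congr1 (fun p : {poly A} => p`_k.+1) (two_term_B aZ a_v a_ahC m f).
rewrite !scale1r !coefB coefZ !coefXM /= !coef_map /= mulr_algl.
by move/(canRL (subrK _))->; rewrite addrC addrA.
Qed.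

(* The coefficient of w^r in sum_(k >= 0) w^k B_(m-k) a(w). *)
Definition Cop (m : int) (r : nat) (f : A) : A :=
  \sum_(k < r.+1) Bop (m - k%:Z) (a f)`_(r - k).

Lemma Cop0 m f : Cop m 0 f = Bop m f.
Proof. by rewrite /Cop big_ord1 subr0 a0. Qed.

Lemma CopS m r f : Cop m r.+1 f = Bop m (a f)`_r.+1 + Cop (m - 1) r f.
Proof.
rewrite /Cop big_ord_recl subr0 subn0; congr (_ + _).
apply: eq_bigr => k _; rewrite subSS; congr (Bop _ _).
by rewrite lift0; lia.
Qed.

Lemma a_Bop m r f :
  (a (Bop m f))`_r.+1 = Bop m (a f)`_r.+1 + (1 - t) *: Cop (m - 1) r f.
Proof.
elim: r m => [|r IHr] m; rewrite a_BopS.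
  by rewrite !a0 Cop0 scalerBl scale1r addrCA addrA.
rewrite IHr CopS; move: (Bop m _) (Bop (m - 1) _) (Cop _ _ _) => X Y Z.
rewrite scalerDr [(1 - t) *: Y]scalerBl scale1r [_ + X]addrC -[LHS]addrA.
by rewrite [_ + _ - _]addrAC.
Qed.

(** Summed over an antidiagonal, the antisymmetric expression of [Bop_antisym] equals its own
    negative, hence is 0. Its two halves share their inner terms up to the factor -t, and one end
    term of each is left over. *)
Lemma Bop_convolution m n f :
  Bop (m - 1 - n%:Z) (Bop m f)
    + (1 - t) *: \sum_(k < n) Bop (m - 1 - k%:Z) (Bop (m - 1 - (n.-1 - k)%:Z) f)
  = t *: Bop m (Bop (m - 1 - n%:Z) f).
Proof.
pose D x y := Bop (x - 1) (Bop y f) - t *: Bop x (Bop (y - 1) f).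
have sumD0 : \sum_(l < n.+1) D (m - l%:Z) (m - (n - l)%:Z) = 0.
  apply: A_char; rewrite {1}(reindex_inj rev_ord_inj) /= -sumrN.
  apply: eq_bigr => l _; rewrite subSS subKn -1?ltnS // /D.
  exact: Bop_antisym.
move: sumD0; rewrite /D sumrB => /subr0_eq.
rewrite big_ord_recr big_ord_recl /= subnn !subr0 subn0.
set S1 := \sum_(k < n) _; set S2 := \sum_(k < n) _; set S := \sum_(k < n) _.
have -> : S1 = S.
  apply: eq_bigr => k _; have := ltn_ord k => ltkn.
  by congr (Bop _ (Bop _ _)); lia.
have -> : S2 = t *: S.
  rewrite scaler_sumr; apply: eq_bigr => k _; rewrite /bump /= add1n.
  by have := ltn_ord k => ltkn; congr (_ *: Bop _ (Bop _ _)); lia.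
rewrite scalerBl scale1r [m - n%:Z - 1]addrAC.
by move=> eqS; rewrite addrCA addrA eqS addrK.
Qed.

Lemma Cop_Bop m r f : Cop (m - 1) r (Bop m f) = t *: Bop m (Cop (m - 1) r f).
Proof.
pose F k i := Bop (m - 1 - k%:Z) (Bop (m - 1 - i%:Z) (a f)`_(r - k.+1 - i)).
transitivity (\sum_(k < r.+1) Bop (m - 1 - k%:Z) (Bop m (a f)`_(r - k))
   + (1 - t) *: \sum_(k < r.+1) \sum_(i < r - k) F k i).
  rewrite scaler_sumr -big_split /=; apply: eq_bigr => k _.
  case: (r - k)%N (subnS r k) => [|j] /= eqj.
    by rewrite big_ord0 scaler0 addr0 !a0.
  rewrite a_Bop linearD linearZ /=; congr (_ + _ *: _).
  by rewrite /Cop linear_sum; apply: eq_bigr => i _; rewrite /F eqj.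
rewrite sum_triangle /Cop (linear_sum (Bop m)) !scaler_sumr -big_split /=.
apply: eq_bigr => n _; rewrite -Bop_convolution; congr (_ + _ *: _).
apply: eq_bigr => k _; rewrite /F; have := ltn_ord k => ltkn.
by rewrite (_ : r - k.+1 - (n.-1 - k) = r - n)%N //; lia.
Qed.

Lemma Cop_Bop_iter m r s f :
  Cop (m - 1) r (iter s (Bop m) f) = t ^+ s *: iter s (Bop m) (Cop (m - 1) r f).
Proof.
elim: s => [|s IHs]; first by rewrite scale1r.
by rewrite !iterS Cop_Bop IHs linearZ /= scalerA exprS.
Qed.

(** Each passage of C_(m-1) through B_m costs a factor t, and (1 - t) (1 + t + ... + t^(s-1)) = 1 -
    t^s. At s = 0 this vanishes, so the value of [s.-1] there does not matter. *)
Lemma a_Bop_iter m r s f :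
  (a (iter s (Bop m) f))`_r.+1 = iter s (Bop m) (a f)`_r.+1
    + (1 - t ^+ s) *: iter s.-1 (Bop m) (Cop (m - 1) r f).
Proof.
elim: s => [|s IHs]; first by rewrite subrr scale0r addr0.
rewrite !iterS a_Bop Cop_Bop_iter IHs linearD linearZ /= -addrA; congr (_ + _).
rewrite scalerA; case: s {IHs} => [|s] /=.
  by rewrite subrr scale0r add0r mulr1.
by rewrite -scalerDl; congr (_ *: _); rewrite !exprS; ring.
Qed.

(** The coefficients 1 - t^s from a and t^s from C_(m-1) add up to 1: a column whose right neighbour
    meets the strip carries no weight. *)
Lemma Cop_iter m r s f :
  Cop m r.+1 (iter s (Bop m) f) = iter s.+1 (Bop m) (a f)`_r.+1
    + iter s (Bop m) (Cop (m - 1) r f).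
Proof.
rewrite CopS a_Bop_iter linearD linearZ Cop_Bop_iter -addrA; congr (_ + _).
case: s => [|s]; first by rewrite /= subrr scale0r add0r scale1r.
by rewrite -scalerDl subrK scale1r.
Qed.

(* Z(w) = B(w) a(1/w): this turns the removal of strips into the Pieri rule. *)
Lemma Zop_sum_Bop b f N : (size (a f) <= N)%N ->
  \sum_(j < N) Bop (b + j%:Z) (a f)`_j = Zop b f.
Proof.
move=> leaN; pose M := maxn N (size (ah f)).
have leaM : (size (a f) <= M)%N by rewrite leq_max leaN.
have lehM : (size (ah f) <= M)%N by rewrite leq_maxr.
transitivity (psum (fun j => Bop (b + j%:Z)) (a f)); first by rewrite (psumE _ leaN).
pose F j l := Zop (b + (j + l)%N%:Z) (ah (a f)`_j)`_l.
transitivity (\sum_(j < M) \sum_(l < M) F j l).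
  rewrite (psumE _ leaM); apply: eq_bigr => j _ /=.
  rewrite /Bop (psumE _ (leq_trans (size_ahS a_ahC f j) lehM)).
  by apply: eq_bigr => l _ /=; rewrite /F PoszD addrA.
rewrite sum_square => [|j l]; last first.
  rewrite /F => /orP[leMj | leMl].
    by rewrite [(a f)`_j]nth_default ?rmorph0 ?coef0 ?linear0 // (leq_trans leaM).
  rewrite -a_ahC [(ah f)`_l]nth_default ?rmorph0 ?coef0 ?linear0 //.
  exact: leq_trans lehM _.
(* The terms with j + l = p share the operator Z_(b+p), and their arguments add up to a coefficient
   of ah(w) a(w) = 1. *)
transitivity (\sum_(p < M + M) Zop (b + p%:Z) (if p == 0%N :> nat then f else 0)).
  apply: eq_bigr => p _; rewrite -ah_aK linear_sum (reindex_inj rev_ord_inj) /=.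
  apply: eq_bigr => i _; have := ltn_ord i => lti.
  by rewrite /F subSS subKn // subnK.
(* An empty range forces a f = 0, and then f = 0, being the constant coefficient of a f. *)
case eqM: (M + M)%N => [|K].
  move: leaM; have -> : M = 0%N by lia.
  rewrite leqn0 size_poly_eq0 => /eqP af0.
  by rewrite big_ord0 -[f]a0 af0 coef0 linear0.
rewrite big_ord_recl /= addr0 big1 ?addr0 // => i _.
by rewrite linear0.
Qed.

(** Once r reaches the degree of a f, the coefficient of w^r in C_(b+r) contains every term B_(b+j)
    a_j. So Z_b amounts to removing M - b boxes with C_M, for M large. *)
Lemma Zop_Cop b r f : (size (a f) <= r.+1)%N -> Cop (b + r%:Z) r f = Zop b f.
Proof.
move=> /Zop_sum_Bop <-; rewrite /Cop (reindex_inj rev_ord_inj) /=.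
apply: eq_bigr => i _; have := ltn_ord i => lti.
by rewrite subSS subKn // -1?subzn //; congr (Bop _ _); lia.
Qed.

(** This is Z(z) a(w) = F(z w) a(w) Z(z), solved by induction on k. The sum also stops at b because
    Z_n = 0 for n < 0; hence the min(a, b) of the theorem. *)
Lemma Zop_a b k f : Zop b%:Z (a f)`_k =
  \sum_(i < (minn k b).+1) g i *: (a (Zop (b - i)%N%:Z f))`_(k - i).
Proof.
have coef_aZ n j : (a (Zop n f))`_j.+1 - (a (Zop (n - 1) f))`_j =
    Zop n (a f)`_j.+1 - t *: Zop (n - 1) (a f)`_j.
  have := congr1 (fun p : {poly A} => p`_j.+1) (two_term_Z aZ a_v a_ahC n f).
  by rewrite !scale1r !coefB coefZ !coefXM /= !coef_map /= mulr_algl.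
elim: k b => [|k IHk] b.
  by rewrite min0n big_ord1 g_0 scale1r !subn0 !a0.
have := coef_aZ b%:Z k; case: b => [|b].
  rewrite !(@Zop_neg (0%:Z - 1)) // (rmorph0 a) coef0 scaler0 !subr0 => <-.
  by rewrite minn0 big_ord1 g_0 scale1r !subn0.
rewrite (_ : b.+1%:Z - 1 = b%:Z); last by lia.
move/esym/(canRL (subrK _))->; rewrite IHk minnSS.
rewrite big_ord_recl [in RHS]big_ord_recl [in RHS]big_ord_recl.
rewrite /= g_0 g_1 !scale1r !subn0 !subSS !subn0 -!addrA; congr (_ + _).
rewrite scalerBl scale1r scalerDr addrA; congr (_ + _).
  by rewrite addrC.
rewrite scaler_sumr; apply: eq_bigr => i _.
by rewrite /bump /= !add1n g_SS scalerA !subSS.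
Qed.

Lemma v_mul r f :
  v r%:Z * f = \sum_(k < r.+1) theta ^+ k *: Zop (r - k)%N%:Z (a f)`_k.
Proof.
have ZopE n x : Zop n%:Z x = \sum_(j < n.+1) Zterm n%:Z j (ah x)`_j.
  rewrite /Zop (@psumE _ _ _ _ (n.+1 + size (ah x))) ?leq_addl //.
  rewrite big_split_ord /= [X in _ + X]big1 ?addr0 // => j _.
  by rewrite /Zterm v_neg ?mul0r ?scaler0 //; lia.
pose F k j := theta ^+ (k + j) *: (v (r - k - j)%N%:Z * (ah (a f)`_k)`_j).
transitivity (\sum_(k < r.+1) \sum_(j < r.+1 - k) F k j); last first.
  apply: eq_bigr => k _; rewrite ZopE scaler_sumr subSn -1?ltnS //.
  apply: eq_bigr => j _; rewrite /Zterm scalerA -exprD subzn //.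
  by rewrite -ltnS.
rewrite sum_antidiagonal.
transitivity (\sum_(p < r.+1)
  theta ^+ p *: (v (r - p)%N%:Z * (if p == 0%N :> nat then f else 0))).
  rewrite big_ord_recl big1 ?addr0 /= ?scale1r ?subn0 // => i _.
  by rewrite mulr0 scaler0.
apply: eq_bigr => p _; rewrite -ah_aK mulr_sumr scaler_sumr.
rewrite (reindex_inj rev_ord_inj) /=; apply: eq_bigr => i _.
have := ltn_ord i => lti.
have -> : (p.+1 - i.+1 = p - i)%N by lia.
have e1 : (p - (p - i) = i)%N by lia.
have e2 : (i + (p - i) = p)%N by lia.
have e3 : (r - i - (p - i) = r - p)%N by lia.
by rewrite /F e1 e2 e3.
Qed.

(** * Removing a strip column by column *)

Lemma Bop1 n : Bop n 1 = v n.
Proof.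
by rewrite /Bop rmorph1 psumC /= addr0 /Zop rmorph1 psumC /= /Zterm subr0 mulr1 scale1r.
Qed.

Fixpoint Vmult (ms : seq nat) : A :=
  if ms is m :: ms' then iter m (Bop (size ms)%:Z) (Vmult ms') else 1.

(** The state on entering column M with r boxes still to remove: C_M if column M + 1 has lost a box,
    a otherwise. *)
Definition strip_op (eps : bool) (M r : nat) (f : A) : A :=
  if eps then Cop M%:Z r f else (a f)`_r.

Lemma strip_op_iter eps M m r f :
  strip_op eps M.+1 r (iter m (Bop M.+1%:Z) f) =
  iter (m + eps) (Bop M.+1%:Z) (strip_op false M r f)
  + (if r is r'.+1 then (if ~~ eps then 1 - t ^+ m else 1) *:
       iter (m + eps - 1) (Bop M.+1%:Z) (strip_op true M r' f) else 0).
Proof.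
have subM : M.+1%:Z - 1 = M%:Z :> int by lia.
case: eps r => [] [|r] /=; rewrite ?addn0 ?addn1 ?subn1 ?addr0 ?scale1r.
- by rewrite Cop0 a0.
- by rewrite Cop_iter subM.
- by rewrite !a0.
by rewrite a_Bop_iter subM.
Qed.

Definition iter_Bop m n : A -> A := iter m (Bop n).

Fact iter_Bop_is_linear m n : linear (iter_Bop m n).
Proof.
elim: m => [|m IHm] c x y //.
by rewrite /iter_Bop !iterS -!/(iter_Bop m n _) IHm linearP.
Qed.
HB.instance Definition _ m n :=
  GRing.isLinear.Build R A A _ (iter_Bop m n) (iter_Bop_is_linear m n).

(** Induction on the columns by [strip_op_iter]. At the end the state acts on 1 and gives either a_r
    1 or B_(-r) 1 = v_(-r); both are 1 for r = 0 and 0 otherwise, so exactly r boxes must have been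
    removed. *)
Lemma strip_op_Vmult eps r ms :
  strip_op eps (size ms) r (Vmult ms) =
  \sum_(s <- bit_words (size ms) | count id s == r)
    strip_weight t eps ms s *: Vmult (strip_remove eps ms s).
Proof.
elim: ms eps r => [|m ms IHms] eps r.
  rewrite big_mkcond big_seq1 /= scale1r /strip_op eq_sym.
  case: eps; last by rewrite rmorph1 coef1; case: eqP.
  rewrite /Cop rmorph1 big_ord_recr /= subnn big1 ?add0r => [|k _]; last first.
    by rewrite coef1 subn_eq0 leqNgt ltn_ord linear0.
  rewrite coef1 Bop1; case: r => [|r]; first by rewrite /= -[RHS]v0.
  by rewrite v_neg //; lia.
rewrite [size _]/= [Vmult _]/= strip_op_iter [bit_words _]/= big_cat !big_map.
congr (_ + _).
  rewrite IHms -/(iter_Bop (m + eps) (size ms).+1%:Z _).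
  rewrite (linear_sum (iter_Bop _ _)) [LHS]big_mkcond [RHS]big_mkcond.
  apply: eq_big_seq => s; rewrite mem_bit_words => /eqP size_s.
  case: ifP => // _; rewrite linearZ /= mul1r size_strip_remove //.
  by rewrite subn0.
case: r => [|r].
  by rewrite big_pred0.
rewrite IHms -/(iter_Bop (m + eps - 1) (size ms).+1%:Z _).
rewrite (linear_sum (iter_Bop _ _)) scaler_sumr [LHS]big_mkcond [RHS]big_mkcond.
apply: eq_big_seq => s; rewrite mem_bit_words => /eqP size_s.
rewrite /= add1n eqSS; case: ifP => // _.
by rewrite linearZ /= scalerA size_strip_remove.
Qed.

(** * Normal ordering *)

Definition Bcomp (l : seq int) (f : A) : A := foldr Bop f l.

Fact Bcomp_is_linear l : linear (Bcomp l).
Proof. by elim: l => [|n l IHl] c x y //=; rewrite -!/(Bcomp l _) IHl linearP. Qed.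
HB.instance Definition _ l :=
  GRing.isLinear.Build R A A _ (Bcomp l) (Bcomp_is_linear l).

Definition NZop (n : int) (l : seq int) (f : A) : A :=
  psum (fun i => Zterm n i \o Bcomp l) (ah f).

Fact NZop_is_linear n l : linear (NZop n l).
Proof. by move=> c x y; rewrite /NZop rmorphD ahZ psumD psumZ. Qed.
HB.instance Definition _ n l :=
  GRing.isLinear.Build R A A _ (NZop n l) (NZop_is_linear n l).

(* Normally ordered product: NBop n l applies the shifts ah of B_n first, then
   the B_m with m in l, and multiplies by the v of B_n last. *)
Definition NBop (n : int) (l : seq int) (f : A) : A :=
  psum (fun i => NZop (n + i%:Z) l) (ah f).

Lemma NBop_nil n f : NBop n [::] f = Bop n f.
Proof. by apply: eq_psum => i x; rewrite /= /NZop /Zop; apply: eq_psum. Qed.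

Lemma NBop1 n l : NBop n l 1 = v n * Bcomp l 1.
Proof.
by rewrite /NBop rmorph1 psumC /= /NZop rmorph1 psumC /= /Zterm addr0 subr0 scale1r.
Qed.

(** The intermediate stage: the ah(1/z) of B_n has been moved past B_b, the ah(theta z) not yet. The
    first move is the raising operator, the second the lowering operator. *)
Definition NBop_mid (n : int) (l : seq int) (b : int) (f : A) : A :=
  psum (fun i => NZop (n + i%:Z) l \o Bop b) (ah f).

Lemma two_term_ah b f : ah (Bop b f) - t%:A *: ('X * ah (Bop (b - 1) f)) =
  map_poly (Bop b) (ah f) - 'X * map_poly (Bop (b - 1)) (ah f).
Proof. by rewrite (two_term_B ahZ ah_v ah_ahC) !scale1r. Qed.

Lemma NBop_raise n l b f :
  NBop n l (Bop b f) - t *: NBop (n + 1) l (Bop (b - 1) f) =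
  NBop_mid n l b f - NBop_mid (n + 1) l (b - 1) f.
Proof.
have shift p : psum (fun i => NZop (n + 1 + i%:Z) l) p =
    psum (fun i => NZop (n + i%:Z) l) ('X * p).
  rewrite psumXM; apply: eq_psum => i z.
  by rewrite (_ : n + 1 + i%:Z = n + i.+1%:Z) //; lia.
rewrite /NBop shift -psumZ -psumB two_term_ah psumB -shift !psum_map.
by [].
Qed.

Lemma NZop_lower n l b f :
  NZop n l (Bop b f) - (t * theta) *: NZop (n - 1) l (Bop (b - 1) f) =
  NZop n (rcons l b) f - theta *: NZop (n - 1) (rcons l (b - 1)) f.
Proof.
have shift p : theta *: psum (fun i => Zterm (n - 1) i \o Bcomp l) p =
    psum (fun i => Zterm n i \o Bcomp l) ('X * p).
  rewrite psumXM /psum scaler_sumr; apply: eq_bigr => i _ /=.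
  by rewrite /Zterm scalerA -exprS (_ : n - 1 - i%:Z = n - i.+1%:Z) //; lia.
rewrite /NZop -scalerA shift -psumZ -psumB two_term_ah psumB -shift !psum_map.
by congr (_ - _ *: _); apply: eq_psum => i z /=; rewrite /Bcomp foldr_rcons.
Qed.

Lemma NBop_lower n l b f :
  NBop_mid n l b f - (t * theta) *: NBop_mid (n - 1) l (b - 1) f =
  NBop n (rcons l b) f - theta *: NBop (n - 1) (rcons l (b - 1)) f.
Proof.
rewrite /NBop_mid /NBop /psum !scaler_sumr -!sumrB; apply: eq_bigr => i _ /=.
by rewrite (_ : n - 1 + i%:Z = n + i%:Z - 1) ?NZop_lower //; lia.
Qed.

(** * Expansion of a product of B's into raising and lowering operators *)

Lemma Bop_small f b N : (size (ah f) <= N)%N -> b + N%:Z <= 0 -> Bop b f = 0.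
Proof.
move=> leN leb; rewrite /Bop (psumE _ leN) big1 // => j _ /=.
by rewrite Zop_neg //; have := ltn_ord j; lia.
Qed.

Lemma NBop_small n l b f N : (size (ah f) <= N)%N -> b + N%:Z <= 0 ->
  [/\ NBop n l (Bop b f) = 0, NBop_mid n l b f = 0 & NBop n (rcons l b) f = 0].
Proof.
move=> leN leb; have ahN := leq_trans (size_ahS ah_ahC _ _) leN.
split; first by rewrite (Bop_small leN leb) /NBop rmorph0 psum0.
  rewrite /NBop_mid /psum big1 // => i _ /=.
  by rewrite (Bop_small (ahN _) leb) linear0.
rewrite /NBop /psum big1 // => i _ /=; rewrite /NZop /psum big1 // => j _ /=.
rewrite /Bcomp foldr_rcons (Bop_small _ leb) -?/(Bcomp l 0) ?linear0 //.
exact: leq_trans (size_ahS ah_ahC _ _) (ahN _).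
Qed.

(** With S the shift of s, (1 - t kappa S) x = (1 - kappa S) y gives x = F(kappa S) y; vanishing
    from K on takes the place of convergence. *)
Lemma geom_inversion (kappa : R) (x y : nat -> A) K :
  (forall s, x s - (t * kappa) *: x s.+1 = y s - kappa *: y s.+1) ->
  (forall s, (K <= s)%N -> x s = 0 /\ y s = 0) ->
  x 0%N = \sum_(s < K) (g s * kappa ^+ s) *: y s.
Proof.
elim: K x y => [|K IHK] x y xy xy0.
  by rewrite big_ord0; have [] := xy0 0%N isT.
have IH := IHK (x \o succn) (y \o succn) (fun s => xy s.+1) (fun s => xy0 s.+1).
have /(canRL (subrK _)) -> := xy 0%N; rewrite [x 1%N]IH big_ord_recl g_0 mulr1 scale1r.
rewrite -addrA; congr (_ + _); case: K {IHK IH} xy0 => [|K] xy0.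
  by have [_ ->] := xy0 1%N isT; rewrite !big_ord0 !scaler0 oppr0 addr0.
rewrite [in RHS]big_ord_recl big_ord_recl /= g_0 g_1 mul1r scale1r scalerDr addrA.
congr (_ + _).
  by rewrite -scaleNr -scalerDl; congr (_ *: _); rewrite expr1; ring.
rewrite scaler_sumr; apply: eq_bigr => i _; rewrite scalerA /bump /= !add1n g_SS.
by congr (_ *: _); rewrite !exprS; ring.
Qed.

(** K depends on degrees and only makes the inversion possible; the range of the resulting sum is
    dictated by y alone. *)
Lemma geom_inversion_trunc (kappa : R) (x y : nat -> A) N :
  (forall s, x s - (t * kappa) *: x s.+1 = y s - kappa *: y s.+1) ->
  (exists K, forall s, (K <= s)%N -> x s = 0 /\ y s = 0) ->
  (forall s, (N <= s)%N -> y s = 0) ->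
  x 0%N = \sum_(s < N) (g s * kappa ^+ s) *: y s.
Proof.
move=> xy [K xy0] y0; pose F s := (g s * kappa ^+ s) *: y s.
rewrite (@geom_inversion kappa x y (N + K)) // => [|s les]; last first.
  by apply: xy0; lia.
rewrite big_split_ord /= [X in _ + X]big1 ?addr0 // => i _.
by rewrite y0 ?scaler0 // leq_addr.
Qed.

(* (c, (k, j)) stands for the operator L_kj if c = true and R_kj otherwise. *)
Definition shift_seq (o : bool * (nat * nat)) (s : nat) (alpha : nat -> int) :
    nat -> int := fun i =>
  alpha i + (if i == o.2.1 then if o.1 then - s%:Z else s%:Z else 0)
    - (if i == o.2.2 then s%:Z else 0).

Definition op_arg (c : bool) : R := if c then theta else 1.

Fixpoint op_sum N (ops : seq (bool * (nat * nat))) (h : (nat -> int) -> A)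
    (alpha : nat -> int) : A :=
  if ops is o :: ops' then
    \sum_(s < N) (g s * op_arg o.1 ^+ s) *: op_sum N ops' h (shift_seq o s alpha)
  else h alpha.

(** The s-th power of R_kj or L_kj lowers this weight by at least s, and a negative weight forces a
    negative entry, where v is 0. A single N therefore bounds all exponents. *)
Definition wt (n : nat) (alpha : nat -> int) : int := \sum_(i < n) i.+1%:Z * alpha i.

Lemma wt_shift n c k j s alpha : (k < j)%N -> (j < n)%N ->
  wt n (shift_seq (c, (k, j)) s alpha) <= wt n alpha - s%:Z.
Proof.
move=> ltkj ltjn; have ltkn := ltn_trans ltkj ltjn.
have sum1 (x : int) m : (m < n)%N ->
    \sum_(i < n) (i.+1%:Z * (if i == m :> nat then x else 0)) = m.+1%:Z * x.
  move=> ltm; rewrite (bigD1 (Ordinal ltm)) //= eqxx big1 ?addr0 // => i neq.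
  by rewrite ifN ?mulr0.
rewrite /wt /shift_seq /=.
under eq_bigr do rewrite mulrBr mulrDr.
rewrite sumrB big_split /= !sum1 // -[j.+1]addn1 PoszD mulrDl mul1r.
have : k.+1%:Z * s%:Z <= j%:Z * s%:Z by rewrite ler_wpM2r.
have : 0 <= k.+1%:Z * s%:Z by rewrite mulr_ge0.
case: c; rewrite ?mulrN; move: (k.+1%:Z * _) (j%:Z * _) (\sum_(_ < n) _); lia.
Qed.

Lemma shift_seq0 o alpha : shift_seq o 0 alpha = alpha.
Proof.
by apply: funext => i; rewrite /shift_seq oppr0 !if_same addr0 subr0.
Qed.

(** Vanishing at negative weight is carried along because it cuts off the series of the next
    operator at N. *)
Definition sums_to n N ops (h X : (nat -> int) -> A) :=
  (forall alpha, wt n alpha < 0 -> X alpha = 0) /\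
  (forall alpha, wt n alpha < N%:Z -> X alpha = op_sum N ops h alpha).

Lemma sums_to_cons n N c k j ops h X Y : (k < j)%N -> (j < n)%N ->
  (forall alpha s (sh := shift_seq (c, (k, j))),
     X (sh s alpha) - (t * op_arg c) *: X (sh s.+1 alpha) =
     Y (sh s alpha) - op_arg c *: Y (sh s.+1 alpha)) ->
  (forall alpha, exists K, forall s, (K <= s)%N ->
     X (shift_seq (c, (k, j)) s alpha) = 0 /\ Y (shift_seq (c, (k, j)) s alpha) = 0) ->
  sums_to n N ops h Y -> sums_to n N ((c, (k, j)) :: ops) h X.
Proof.
move=> ltkj ltjn XY XY0 [Y0 Ysum].
have Xsum alpha M : wt n alpha < M%:Z -> X alpha =
    \sum_(s < M) (g s * op_arg c ^+ s) *: Y (shift_seq (c, (k, j)) s alpha).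
  move=> ltM; rewrite -{1}[alpha](shift_seq0 (c, (k, j))).
  apply: (geom_inversion_trunc (x := fun s => X (shift_seq (c, (k, j)) s alpha))
    (y := fun s => Y (shift_seq (c, (k, j)) s alpha))) => // s leMs.
  by apply: Y0; have := wt_shift c s alpha ltkj ltjn; lia.
split=> alpha lt_alpha; first by rewrite (Xsum _ 0%N) // big_ord0.
rewrite (Xsum _ N) //=; apply: eq_bigr => s _; rewrite Ysum //.
by have := wt_shift c s alpha ltkj ltjn; lia.
Qed.

Definition slice (alpha : nat -> int) i m : seq int := [seq alpha k | k <- iota i m].

Definition prefix_prod k (alpha : nat -> int) : A := \prod_(i < k) v (alpha i).

Fixpoint row_ops k j m : seq (bool * (nat * nat)) :=
  if m is m'.+1 then [:: (false, (k, j)), (true, (k, j)) & row_ops k j.+1 m'] else [::].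

Fixpoint all_ops k m : seq (bool * (nat * nat)) :=
  if m is m'.+1 then row_ops k k.+1 m' ++ all_ops k.+1 m' else [::].

(* The sum over the operators of row k at positions >= j and of all later rows:
   B_(alpha k) has been moved past the positions < j. *)
Definition row_state k j m alpha :=
  prefix_prod k alpha *
    NBop (alpha k) (slice alpha k.+1 (j - k.+1)) (Bcomp (slice alpha j m) 1).

Definition row_mid_state k j m alpha :=
  prefix_prod k alpha *
    NBop_mid (alpha k) (slice alpha k.+1 (j - k.+1)) (alpha j)
      (Bcomp (slice alpha j.+1 m) 1).

Lemma slice_shift c k j s alpha i m :
  (forall x, (i <= x < i + m)%N -> (x != k) && (x != j)) ->
  slice (shift_seq (c, (k, j)) s alpha) i m = slice alpha i m.
Proof.
move=> out; apply/eq_in_map => x; rewrite mem_iota => /out/andP[nk nj].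
by rewrite /shift_seq /= (negPf nk) (negPf nj) addr0 subr0.
Qed.

Lemma prefix_prod_shift c k j s alpha : (k < j)%N ->
  prefix_prod k (shift_seq (c, (k, j)) s alpha) = prefix_prod k alpha.
Proof.
move=> ltkj; apply: eq_bigr => i _; congr v; have ltik := ltn_ord i.
rewrite /shift_seq /= !ifN ?addr0 ?subr0 //; lia.
Qed.

Lemma shift_seq_l k j c s alpha : (k < j)%N ->
  shift_seq (c, (k, j)) s alpha k = alpha k + (if c then - s%:Z else s%:Z).
Proof. by move=> ltkj; rewrite /shift_seq /= eqxx ltn_eqF // subr0. Qed.

Lemma shift_seq_r k j c s alpha : (k < j)%N ->
  shift_seq (c, (k, j)) s alpha j = alpha j - s%:Z.
Proof. by move=> ltkj; rewrite /shift_seq /= eqxx gtn_eqF // addr0. Qed.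

Lemma row_state_raise k j m N ops h : (k < j)%N ->
  sums_to (j + m.+1) N ops h (row_mid_state k j m) ->
  sums_to (j + m.+1) N ((false, (k, j)) :: ops) h (row_state k j m.+1).
Proof.
move=> ltkj; apply: sums_to_cons => //; first by lia.
  move=> alpha s /=; rewrite /op_arg mulr1 scale1r /row_state /row_mid_state /=.
  rewrite -!/(slice _ _ _).
  rewrite !prefix_prod_shift // !slice_shift; try by move=> x; lia.
  rewrite !shift_seq_l // !shift_seq_r //.
  rewrite !scalerAr -!mulrBr; congr (_ * _).
  rewrite (_ : alpha k + s.+1%:Z = alpha k + s%:Z + 1); last by lia.
  rewrite (_ : alpha j - s.+1%:Z = alpha j - s%:Z - 1); last by lia.
  exact: NBop_raise.
move=> alpha; pose f := Bcomp (slice alpha j.+1 m) 1.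
(* From this exponent on, entry j is so negative that B at j involves only Z's of negative index. *)
exists (`|alpha j| + size (ah f))%N => s les.
rewrite /row_state /row_mid_state /= -!/(slice _ _ _).
rewrite !slice_shift; try by move=> x; lia.
rewrite !shift_seq_r // -!/(Bcomp _ 1).
have [|-> -> _] := @NBop_small (shift_seq (false, (k, j)) s alpha k)
  (slice alpha k.+1 (j - k.+1)) (alpha j - s%:Z) f _ (leqnn _).
  by move: les; move: (size _) => M; lia.
by rewrite !mulr0.
Qed.

Lemma row_state_lower k j m N ops h : (k < j)%N ->
  sums_to (j + m.+1) N ops h (row_state k j.+1 m) ->
  sums_to (j + m.+1) N ((true, (k, j)) :: ops) h (row_mid_state k j m).
Proof.
move=> ltkj; have sliceS alpha : slice alpha k.+1 (j.+1 - k.+1) =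
    rcons (slice alpha k.+1 (j - k.+1)) (alpha j).
  rewrite subSn // /slice -[(j - k.+1).+1]addn1 iotaD map_cat /= cats1.
  by congr (rcons _ (alpha _)); lia.
apply: sums_to_cons => //; first by lia.
  move=> alpha s /=; rewrite /op_arg /row_state /row_mid_state /= !sliceS.
  rewrite !prefix_prod_shift // !slice_shift; try by move=> x; lia.
  rewrite !shift_seq_l // !shift_seq_r //.
  rewrite !scalerAr -!mulrBr; congr (_ * _).
  rewrite (_ : alpha k - s.+1%:Z = alpha k - s%:Z - 1); last by lia.
  rewrite (_ : alpha j - s.+1%:Z = alpha j - s%:Z - 1); last by lia.
  exact: NBop_lower.
move=> alpha; pose f := Bcomp (slice alpha j.+1 m) 1.
exists (`|alpha j| + size (ah f))%N => s les.
rewrite /row_state /row_mid_state /= sliceS.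
rewrite !slice_shift; try by move=> x; lia.
rewrite !shift_seq_r //.
have [|_ -> ->] := @NBop_small (shift_seq (true, (k, j)) s alpha k)
  (slice alpha k.+1 (j - k.+1)) (alpha j - s%:Z) f _ (leqnn _).
  by move: les; move: (size _) => M; lia.
by rewrite !mulr0.
Qed.

Lemma sums_to_row k j m N ops h : (k < j)%N ->
  sums_to (j + m) N ops h (row_state k (j + m) 0) ->
  sums_to (j + m) N (row_ops k j m ++ ops) h (row_state k j m).
Proof.
elim: m j => [|m IHm] j ltkj; first by rewrite addn0.
move=> last_state; apply/row_state_raise/row_state_lower => //.
by rewrite -addSnnS; apply: IHm; [lia | rewrite addSnnS].
Qed.

(** The first k rows have already become factors v, the others are still B's. When no B is left, a
    negative weight means a negative entry and the product of the v's is 0. *)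
Lemma sums_to_all k m N :
  sums_to (k + m) N (all_ops k m) (prefix_prod (k + m))
    (fun alpha => prefix_prod k alpha * Bcomp (slice alpha k m) 1).
Proof.
elim: m k => [|m IHm] k.
  split=> alpha lt_alpha; rewrite ?addn0 /= ?addn0 mulr1 // /prefix_prod.
  have [i neg_i | nneg] := pickP (fun i : 'I_k => alpha i < 0)%R.
    by rewrite (bigD1 i) //= v_neg ?mul0r.
  move: lt_alpha; rewrite addn0 /wt ltNge sumr_ge0 // => i _.
  by rewrite mulr_ge0 // leNgt nneg.
rewrite /= -addSnnS; have := IHm k.+1; set X := fun alpha => _ => sumX.
(* Past the last position the ah's of B_(alpha k) act on 1, so only v_(alpha k) remains of it and
   joins the prefix. *)
have eqX : X = row_state k (k.+1 + m) 0.
  apply: funext => alpha; rewrite /X /row_state /= addKn NBop1 mulrA.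
  by rewrite /prefix_prod big_ord_recr.
have eqT : (fun alpha => prefix_prod k alpha *
    Bop (alpha k) (Bcomp (slice alpha k.+1 m) 1)) = row_state k k.+1 m.
  by apply: funext => alpha; rewrite /row_state subnn /= NBop_nil.
by rewrite eqT; apply: sums_to_row; rewrite // -eqX.
Qed.

End Operators.

(** * Shift homomorphisms *)

Definition generated_by (R : comNzRingType) (A : comAlgType R) (v : int -> A) :=
  forall P : A -> Prop,
  (forall c x, P x -> P (c *: x)) -> (forall x y, P x -> P y -> P (x + y)) ->
  P 1 -> (forall x y, P x -> P y -> P (x * y)) -> (forall n, P (v n)) ->
  forall x, P x.

Section ShiftRelations.
Variables (R : comNzRingType) (A : comAlgType R) (v : int -> A).
Hypothesis A_ind : generated_by v.
Hypothesis v_neg : forall n : int, n < 0 -> v n = 0.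

Definition is_shift (G : nat -> R) (S : {rmorphism A -> {poly A}}) :=
  (forall c x, S (c *: x) = c%:A *: S x) /\
  (forall n k, (S (v n))`_k = G k *: v (n - k%:Z)).

(** [is_shift] says S(v(z)) = G(z w) v(z), and the conditions on G say G(u) = (1 - q u) / (1 - p
    u). *)
Lemma is_shift_rel G S p q : is_shift G S -> G 0 = 1 -> G 1 = p - q ->
  (forall k, G k.+2 = p * G k.+1) -> shift_rel v p q S.
Proof.
move=> [_ SE] G0 G1 GS n; apply/polyP => k.
rewrite !coefB !coefZ !coefXM !coefC !mulr_algl !SE; case: k => [|k] /=.
  by rewrite G0 scale1r !scaler0 !subr0.
rewrite (_ : n - 1 - k%:Z = n - k.+1%:Z); last by lia.
case: k => [|k] /=; last by rewrite GS -scalerA subrr scaler0 subr0.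
by rewrite G1 G0 scale1r -scalerBl addrAC subrr sub0r scaleNr sub0r.
Qed.

Lemma coef_shift0 G S x : is_shift G S -> G 0 = 1 -> (S x)`_0 = x.
Proof.
move=> [SZ SE] G0; elim/A_ind: x => [c x IH|x y IHx IHy||x y IHx IHy|n].
- by rewrite SZ coefZ IH mulr_algl.
- by rewrite rmorphD coefD IHx IHy.
- by rewrite rmorph1 coef1.
- by rewrite rmorphM coef0M IHx IHy.
by rewrite SE G0 scale1r subr0.
Qed.

Lemma shiftC G H S T x i j : is_shift G S -> is_shift H T ->
  (S (T x)`_i)`_j = (T (S x)`_j)`_i.
Proof.
move=> [SZ SE] [TZ TE].
elim/A_ind: x i j => [c x IH|x y IHx IHy||x y IHx IHy|n] i j.
- by rewrite !(SZ, TZ) !coefZ !mulr_algl !(SZ, TZ) !coefZ !mulr_algl IH.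
- by rewrite !(rmorphD, coefD) IHx IHy.
- rewrite !rmorph1 !coef1.
  by case: i j => [|i] [|j]; rewrite ?rmorph1 ?rmorph0 ?coef1 ?coef0.
- rewrite !rmorphM !coefM !rmorph_sum !coef_sum.
  under eq_bigr do rewrite rmorphM coefM.
  under [RHS]eq_bigr do rewrite rmorphM coefM.
  rewrite exchange_big /=; apply: eq_bigr => k _; apply: eq_bigr => l _.
  by rewrite IHx IHy.
rewrite SE TE SZ TZ !coefZ !mulr_algl SE TE !scalerA [G j * _]mulrC.
by congr (_ *: v _); lia.
Qed.

Lemma shift_inverse (t : R) G H S T x k : is_shift G S -> is_shift H T ->
  shift_rel v 1 t S -> shift_rel v t 1 T ->
  \sum_(i < k.+1) (T (S x)`_(k - i))`_i = if k == 0%N then x else 0.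
Proof.
move=> [SZ SE] [TZ TE] relS relT.
(* Evaluation at 'X identifies the variable of S with that of T: [U] is T(w) S(w), a ring morphism,
   so it suffices to look at generators. *)
pose U y := (map_poly T (S y)).['X].
have UM y z : U (y * z) = U y * U z by rewrite /U !rmorphM hornerM.
have coefU y : (U y)`_k = \sum_(i < k.+1) (T (S y)`_(k - i))`_i.
  rewrite /U (@horner_coef_wide _ (maxn k.+1 (size (S y)))); last first.
    by rewrite (leq_trans (size_poly _ _)) // leq_maxr.
  rewrite coef_sum -(big_mkord xpredT (fun i => (((map_poly T (S y))`_i) * 'X^i)`_k)).
  rewrite (big_cat_nat _ (leq_maxl _ _)) //= [X in _ + X]big_nat.
  rewrite [X in _ + X]big1 ?addr0 => [|i /andP[lti _]]; last by rewrite coefMXn lti.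
  rewrite big_mkord (reindex_inj rev_ord_inj) /=; apply: eq_bigr => i _.
  rewrite coef_map subSS coefMXn ltnNge leq_subr /= subKn //.
  by rewrite -ltnS.
have U_id y : U y = y%:P.
  elim/A_ind: y => [c y IH|y z IHy IHz||y z IHy IHz|n].
  - rewrite /U SZ -mul_polyC rmorphM hornerM /= map_polyC hornerC -/(U y) IH.
    by rewrite /= TZ (rmorph1 T) alg_polyC -polyCM mulr_algl.
  - by rewrite /U !rmorphD hornerD -/(U y) -/(U z) IHy IHz.
  - by rewrite /U !rmorph1 hornerC.
  - by rewrite UM IHy IHz rmorphM.
  have stepU m : U (v m) = 'X * U (v (m - 1)) + (v m)%:P - 'X * (v (m - 1))%:P.
    rewrite /U; have /(canRL (subrK _)) -> := relS m.
    rewrite scale1r scale1r -mul_polyC !(rmorphD, rmorphN, rmorphM) /=.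
    rewrite !map_polyC map_polyX /=.
    rewrite !(hornerD, hornerN, hornerM, hornerC, hornerX) -/(U _) TZ (rmorph1 T).
    have /(canRL (subrK _)) -> := relT m; rewrite !scale1r -!mul_polyC.
    by ring.
  (* The factors of S and T cancel, so the defect satisfies d m = 'X * d (m - 1), and it is 0 for
     negative m. *)
  pose d m := U (v m) - (v m)%:P.
  have step_d m : d m = 'X * d (m - 1).
    by rewrite /d stepU mulrBr addrAC addrK.
  apply/eqP; rewrite -subr_eq0 -/(d n); apply/eqP.
  have [m] : {m : nat | n < m%:Z} by exists (`|n|.+1)%N; lia.
  elim: m n => [|m IHm] n lt_nm; last by rewrite step_d IHm ?mulr0 //; lia.
  by rewrite /d v_neg // /U !rmorph0 horner0 subrr.
by rewrite -coefU U_id coefC.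
Qed.

End ShiftRelations.

Section Shift.
Variable R : comNzRingType.
Local Notation Lam := {malg R[{cmonom nat}]}.

Lemma malgUZ (m : {cmonom nat}) (c : R) : << c *g m >> = c *: (<< m >> : Lam).
Proof.
apply/malgP => k; rewrite mcoeffZ [LHS]mcoeffU.
by rewrite (mcoeffU m (1 : R) k) mulr_natr.
Qed.

Lemma malg_monomial_prod (m : {cmonom nat}) :
  exists l : seq nat, << m >> = \prod_(i <- l) << ucm i >> :> Lam.
Proof.
have [n] := ubnP (mdeg m); elim: n m => // n IHn m; rewrite ltnS => le_mn.
have [->|] := eqVneq m mone; first by exists [::]; rewrite big_nil.
rewrite -mdeg_eq0 => deg_m.
have [i mi] : exists i, i \in finsupp m.
  have [supp0 | [i]] := fset_0Vmem (finsupp m); last by exists i.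
  by move: deg_m; rewrite mdegE supp0 big_seq_fset0.
have def_m : m = mmul (ucm i) (divcm m (ucm i)).
  apply/eqP/cmP => k; rewrite cmM divcmE !ucmE.
  case: eqP => [<-|] //=; last by rewrite subn0.
  by rewrite subnKC // lt0n cmE_neq0.
have [|l def_l] := IHn (divcm m (ucm i)).
  by move: le_mn; rewrite {1}def_m mdegM mdegU.
exists (i :: l); rewrite big_cons -def_l {1}def_m.
by rewrite [RHS]malgM_def fgmulUU mul1r.
Qed.

Lemma malg_alg_ind (P : Lam -> Prop) :
  (forall c x, P x -> P (c *: x)) -> (forall x y, P x -> P y -> P (x + y)) ->
  P 1 -> (forall x y, P x -> P y -> P (x * y)) -> (forall r, P << ucm r >>) ->
  forall x, P x.
Proof.
move=> PZ PD P1 PM PU x.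
have P0 : P 0 by rewrite -(scale0r (1 : Lam)); apply: PZ.
rewrite (monalgE x); apply: (big_rec P) => [|m y _ Py]; first exact: P0.
apply: (PD) Py; rewrite malgUZ; apply: PZ.
have [l ->] := malg_monomial_prod m.
apply: (big_rec P) => [|i z _ Pz]; first exact: P1.
by apply: PM Pz; apply: PU.
Qed.

Definition vgen (a : int) : Lam :=
  match a with
  | Posz 0 => 1
  | Posz r.+1 => << ucm r >>
  | Negz _ => 0
  end.

Section ShiftHom.
Variable G : nat -> R.

Definition shift_gen (r : nat) : {poly Lam} :=
  \poly_(k < r.+2) (G k *: vgen (r.+1%:Z - k%:Z)).

Definition shift_mon (m : {cmonom nat}) : {poly Lam} :=
  \prod_(i <- finsupp m) shift_gen i ^+ m i.

Lemma shift_monE (d : {fset nat}) (m : {cmonom nat}) : (finsupp m `<=` d)%fset ->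
  shift_mon m = \prod_(i <- d) shift_gen i ^+ m i.
Proof.
move=> sub; rewrite /shift_mon; apply: big_fset_incl => // i _.
by rewrite memNfinsupp => /eqP ->.
Qed.

Fact shift_mon_mmorphism : mmorphism shift_mon.
Proof.
split=> [m1 m2|]; last by rewrite /shift_mon mdom1 big_seq_fset0.
pose d := (finsupp m1 `|` finsupp m2)%fset.
rewrite !(@shift_monE d) ?mdomD ?fsubsetUl ?fsubsetUr ?fsubset_refl //.
by rewrite -big_split; apply: eq_bigr => i _; rewrite cmM exprD.
Qed.
HB.instance Definition _ :=
  isMultiplicative.Build {cmonom nat} {poly Lam} shift_mon shift_mon_mmorphism.

Definition shift_cst : {rmorphism R -> {poly Lam}} :=
  (@polyC Lam) \o (@malgC {cmonom nat} R).

Definition shift : {rmorphism Lam -> {poly Lam}} := mmap shift_cst shift_mon.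

Lemma malg_scaleA (c : R) : c%:A = malgC c :> Lam.
Proof. by rewrite -mul_malgC mulr1. Qed.

Lemma shiftZ c x : shift (c *: x) = c%:A *: shift x.
Proof. by rewrite /shift /= mmapZ malg_scaleA -mul_polyC. Qed.

Lemma vgen_neg (n : int) : n < 0 -> vgen n = 0.
Proof. by case: n. Qed.

Hypothesis G_0 : G 0 = 1.

Lemma shift_v n k : (shift (vgen n))`_k = G k *: vgen (n - k%:Z).
Proof.
have [n_lt0 | n_ge0] := ltP n 0.
  by rewrite !vgen_neg ?rmorph0 ?coef0 ?scaler0 //; lia.
case: n n_ge0 => // [[|r]] _.
  rewrite rmorph1 coef1; case: k => [|k]; first by rewrite G_0 scale1r.
  by rewrite [vgen (_ - _)]vgen_neg ?scaler0 //; lia.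
have -> : shift (vgen r.+1) = shift_cst 1 * shift_mon (ucm r) by exact: mmapU.
rewrite rmorph1 mul1r /shift_mon mdomU big_seq_fset1.
rewrite cmUU expr1 coef_poly; case: ltnP => // lek.
by rewrite vgen_neg ?scaler0 //; lia.
Qed.

Lemma shift_is_shift : is_shift vgen G shift.
Proof. by split; [exact: shiftZ | exact: shift_v]. Qed.

End ShiftHom.

Lemma vgen_generates : generated_by vgen.
Proof.
move=> P PZ PD P1 PM Pv; apply: (malg_alg_ind PZ PD P1 PM) => r.
exact: (Pv r.+1).
Qed.

End Shift.

Lemma t_neq0 : t != 0.
Proof. by rewrite /t tofrac_eq0 polyX_eq0. Qed.

(** The coefficients of 1 / F(u) = (1 - t u) / (1 - u). *)
Definition inv_geom_coef (s : nat) : Qt := if s == 0%N then 1 else 1 - t.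

Definition acoef k : Qt_theta := (inv_geom_coef k)%:P.
Definition hcoef k : Qt_theta := (geom_coef k)%:P.

Lemma hcoef0 : hcoef 0 = 1. Proof. by []. Qed.
Lemma acoef0 : acoef 0 = 1. Proof. by []. Qed.

Lemma hcoef1 : hcoef 1 = t%:P - 1.
Proof. by rewrite /hcoef /geom_coef /= expr1 mulrBl mul1r mulVf ?t_neq0 // polyCB. Qed.

Lemma mul_exprSS (K : comNzRingType) (x y : K) k :
  y * x ^+ k.+2 = x * (y * x ^+ k.+1).
Proof. by rewrite exprS mulrCA. Qed.

Lemma hcoefSS k : hcoef k.+2 = t%:P * hcoef k.+1.
Proof. by rewrite /hcoef -polyCM; congr (_%:P); apply: mul_exprSS. Qed.

Lemma acoef1 : acoef 1 = 1 - t%:P.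
Proof. by rewrite /acoef /inv_geom_coef polyCB. Qed.

Lemma acoefSS k : acoef k.+2 = 1 * acoef k.+1.
Proof. by rewrite mul1r. Qed.

Definition sa : {rmorphism Lambda -> {poly Lambda}} := shift acoef.
Definition sh : {rmorphism Lambda -> {poly Lambda}} := shift hcoef.

Lemma sa_is_shift : is_shift v acoef sa.
Proof. exact: shift_is_shift acoef0. Qed.

Lemma sh_is_shift : is_shift v hcoef sh.
Proof. exact: shift_is_shift hcoef0. Qed.

Lemma v_generates : generated_by v.
Proof. exact: vgen_generates. Qed.

Lemma v_lt0 (n : int) : n < 0 -> v n = 0.
Proof. by case: n. Qed.

Lemma two_neq0 : (2%:R : Qt) != 0.
Proof.
by rewrite -(rmorph_nat (@tofrac {poly rat})) tofrac_eq0 -polyC_natr polyC_eq0.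
Qed.

Lemma Lambda_char (x : Lambda) : x = - x -> x = 0.
Proof.
move=> xN; have x2 : x + x = 0 by rewrite {1}xN addNr.
have : (2%:R : Qt)^-1%:P *: (x + x) = x.
  rewrite -mulr2n -scaler_nat scalerA -polyC_natr -polyCM mulVf ?two_neq0 //.
  by rewrite scale1r.
by rewrite x2 scaler0.
Qed.

(** * Monomials in raising and lowering operators *)

Local Notation opmon2 := (opmon * opmon)%type.

Definition opexp (d : opmon2) (o : bool * (nat * nat)) : nat :=
  if o.1 then d.1 o.2 else d.2 o.2.

(* Exponents of the L_p are indexed by (true, p), those of the R_p by (false, p). *)
Definition opsupp (d : opmon2) : seq (bool * (nat * nat)) :=
  [seq (true, p) | p <- finsupp d.1] ++ [seq (false, p) | p <- finsupp d.2].

Definition opdelta (o : bool * (nat * nat)) (k : nat) : int :=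
  (if k == o.2.1 then if o.1 then - 1 else 1 else 0) - (if k == o.2.2 then 1 else 0).

Definition opcoef (R : comNzRingType) (theta : R) (g : nat -> R)
    (o : bool * (nat * nat)) (s : nat) : R := g s * op_arg theta o.1 ^+ s.

Lemma mem_opsupp d o : (o \in opsupp d) = (opexp d o != 0%N).
Proof.
case: o => c p; rewrite mem_cat; case: c; rewrite /opexp /= -mem_finsupp.
  rewrite mem_map => [|x y [] //]; rewrite orbC; case: mapP => [[x _] //|_] //=.
rewrite [X in _ || X]mem_map => [|x y [] //]; case: mapP => [[x _] //|_] //=.
Qed.

Lemma opsupp_uniq d : uniq (opsupp d).
Proof.
rewrite cat_uniq !map_inj_uniq ?fset_uniq //= ?andbT; try by move=> x y [].
by apply/hasPn => _ /mapP[p _ ->]; apply/mapP => [[]].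
Qed.

(** Since exponent 0 contributes the neutral element, every monomial can be read off one common list
    of operators. *)
Lemma big_opsupp (T : Type) (idx : T) (op : Monoid.com_law idx) d r
    (F : bool * (nat * nat) -> nat -> T) :
  uniq r -> (forall o, o \notin r -> opexp d o = 0%N) -> (forall o, F o 0%N = idx) ->
  \big[op/idx]_(o <- opsupp d) F o (opexp d o) = \big[op/idx]_(o <- r) F o (opexp d o).
Proof.
move=> uniq_r out F0.
rewrite [LHS](bigID (mem r)) /= [X in op _ X]big1 ?Monoid.mulm1; last first.
  by move=> o nr; rewrite out.
rewrite [RHS](bigID (mem (opsupp d))) /=.
rewrite [X in _ = op _ X]big1 ?Monoid.mulm1; last first.
  by move=> o; rewrite mem_opsupp negbK => /eqP ->.
rewrite -[LHS]big_filter -[RHS]big_filter; apply: perm_big; apply: uniq_perm.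
- by rewrite filter_uniq ?opsupp_uniq.
- by rewrite filter_uniq.
by move=> o; rewrite !mem_filter andbC.
Qed.

Lemma big_opsuppE (T : Type) (idx : T) (op : Monoid.law idx) d
    (F : bool * (nat * nat) -> nat -> T) :
  \big[op/idx]_(o <- opsupp d) F o (opexp d o) =
  op (\big[op/idx]_(p <- finsupp d.1) F (true, p) (d.1 p))
     (\big[op/idx]_(p <- finsupp d.2) F (false, p) (d.2 p)).
Proof. by rewrite big_cat !big_map. Qed.

Lemma coef_opsupp d :
  lower_coef d.1 * raise_coef d.2 =
  \prod_(o <- opsupp d) opcoef theta hcoef o (opexp d o).
Proof.
rewrite big_opsuppE; congr (_ * _); apply: eq_bigr => p _.
by rewrite /opcoef /op_arg expr1n mulr1.
Qed.

Lemma act_mon_coef T e alpha k (D : nat * nat -> int) :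
  (forall p beta, (T p beta)@_k = beta@_k + D p) ->
  (act_mon T e alpha)@_k = alpha@_k + \sum_(p <- finsupp e) D p *+ e p.
Proof.
move=> TD; rewrite /act_mon; elim: (finsupp e : seq _) => [|p r IHr] /=.
  by rewrite big_nil addr0.
rewrite big_cons addrCA -IHr; move: (foldr _ _ _) => beta.
by elim: (e p) => [|n IHn]; rewrite /= ?add0r // TD IHn mulrSr addrAC.
Qed.

Lemma act_coef d alpha k :
  (act_mon lower_op d.1 (act_mon raise_op d.2 alpha))@_k =
  alpha@_k + \sum_(o <- opsupp d) opdelta o k *+ opexp d o.
Proof.
rewrite (big_opsuppE _ _ (fun o s => opdelta o k *+ s)) addrCA addrC.
rewrite (@act_mon_coef _ _ _ _ (fun p => opdelta (true, p) k)) => [|p beta].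
  rewrite (@act_mon_coef _ _ _ _ (fun p => opdelta (false, p) k)) => [|p beta].
    by [].
  rewrite /raise_op !mcoeffB mcoeffD !mcoeffU /opdelta /= -addrA.
  by rewrite ![_ == k]eq_sym; do 2!case: (k == _).
rewrite /lower_op !mcoeffB !mcoeffU /opdelta /= -addrA.
by rewrite ![_ == k]eq_sym; do 2!case: (k == _).
Qed.

Definition opupd (o : bool * (nat * nat)) (s : nat) (d : opmon2) : opmon2 :=
  if o.1 then ([fsfun d.1 with o.2 |-> s], d.2) else (d.1, [fsfun d.2 with o.2 |-> s]).

Lemma opexp_upd o s d o' : opexp (opupd o s d) o' = if o' == o then s else opexp d o'.
Proof.
case: o o' => [c p] [c' p']; rewrite /opexp /opupd xpair_eqE.
by case: c; case: c'; rewrite //= fsfun_withE.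
Qed.

Lemma opexp_inj d d' : opexp d =1 opexp d' -> d = d'.
Proof.
case: d d' => [e f] [e' f'] eqd; congr pair; apply/fsfunP => p.
  exact: (eqd (true, p)).
exact: (eqd (false, p)).
Qed.

Fixpoint dops N (ops : seq (bool * (nat * nat))) : seq opmon2 :=
  if ops is o :: ops' then [seq opupd o s d | s <- iota 0 N, d <- dops N ops']
  else [:: ([fsfun], [fsfun])].

Lemma dopsP N ops d : uniq ops ->
  (d \in dops N ops) <-> (forall o, o \notin ops -> opexp d o = 0%N) /\
                        (forall o, o \in ops -> (opexp d o < N)%N).
Proof.
elim: ops d => [|o ops IHops] d /=.
  rewrite inE => _; split=> [/eqP ->|[d0 _]].
    by split=> // -[[] p] _; rewrite /opexp /= fsfunE.
  apply/eqP/opexp_inj => o; rewrite d0 //.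
  by case: o => [[] p]; rewrite /opexp /= fsfunE.
case/andP=> o_notin uniq_ops; split.
  case/allpairsP=> [[s d']] /= [s_lt /(IHops d' uniq_ops) [out lt_exp] ->].
  rewrite mem_iota /= in s_lt; split=> o'; rewrite inE opexp_upd; case: eqP => //=.
    by move=> _; apply: out.
  by move=> _; apply: lt_exp.
case=> out lt_exp; apply/allpairsP; exists (opexp d o, opupd o 0 d); split=> /=.
- by rewrite mem_iota /=; apply: lt_exp; rewrite mem_head.
- apply/IHops => //; split=> o' o'_in; rewrite opexp_upd; case: eqP => //.
  + by move/eqP=> neq; apply: out; rewrite inE negb_or neq.
  + by move=> eqo; rewrite -eqo o'_in in o_notin.
  by move=> _; apply: lt_exp; rewrite inE o'_in orbT.
apply: opexp_inj => o'; rewrite !opexp_upd; by case: eqP => [->|].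
Qed.

Lemma dops_uniq N ops : uniq ops -> uniq (dops N ops).
Proof.
elim: ops => // o ops IHops /= /andP[o_notin uniq_ops].
apply: allpairs_uniq; [exact: iota_uniq | exact: IHops |].
move=> [s d] [s' d'] /allpairsP[[? ?] /= [_ d_in [-> ->]]].
move=> /allpairsP[[? ?] /= [_ d'_in [-> ->]]] /= eq_upd.
have [/(dopsP _ _ uniq_ops)[d0 _] /(dopsP _ _ uniq_ops)[d'0 _]] := (d_in, d'_in).
have eq_exp o' := congr1 (fun x => opexp x o') eq_upd.
congr pair; first by have := eq_exp o; rewrite !opexp_upd eqxx.
apply: opexp_inj => o'; have := eq_exp o'; rewrite !opexp_upd.
by case: eqP => // -> _; rewrite d0 ?d'0.
Qed.

(** Flattens the nested sums of the normal ordering into one sum over pairs of exponent families,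
    the index set of [Vi]. *)
Lemma op_sum_dops (R : comNzRingType) (A : comAlgType R) (theta : R) g N ops
    (h : (nat -> int) -> A) alpha : uniq ops ->
  \sum_(d <- dops N ops) (\prod_(o <- ops) opcoef theta g o (opexp d o)) *:
     h (fun k => alpha k + \sum_(o <- ops) opdelta o k *+ opexp d o) =
  op_sum theta g N ops h alpha.
Proof.
elim: ops alpha => [|o ops IHops] alpha /=.
  move=> _; rewrite big_seq1 big_nil scale1r; congr h; apply: funext => k.
  by rewrite big_nil addr0.
case/andP=> o_notin uniq_ops; rewrite big_allpairs_dep /=.
rewrite -(big_mkord xpredT (fun s => (g s * op_arg theta o.1 ^+ s) *:
  op_sum theta g N ops h (shift_seq o s alpha))).
rewrite /index_iota subn0; apply: eq_bigr => s _.
rewrite -IHops // scaler_sumr; apply: eq_bigr => d _.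
have exp_ops o' : o' \in ops -> opexp (opupd o s d) o' = opexp d o'.
  by move=> o'_in; rewrite opexp_upd ifN //; apply: contraNneq o_notin => <-.
rewrite big_cons scalerA {1}opexp_upd eqxx; congr (_ * _ *: h _).
  by apply: eq_big_seq => o' /exp_ops ->.
apply: funext => k; rewrite big_cons opexp_upd eqxx addrA; congr (_ + _).
  rewrite /shift_seq /opdelta mulrnBl !addrA; congr (_ + _ - _).
    by case: ifP => _; [case: (o.1); rewrite ?mulNrn natz | rewrite mul0rn].
  by case: ifP => _; [rewrite natz | rewrite mul0rn].
by apply: eq_big_seq => o' /exp_ops ->.
Qed.

Lemma mem_row_ops k j m o :
  (o \in row_ops k j m) = (o.2.1 == k) && (j <= o.2.2 < j + m)%N.
Proof.
case: o => c [k' j'] /=; elim: m j => [|m IHm] j /=.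
  by rewrite addn0; case: eqP => //= _; rewrite in_nil; lia.
rewrite !inE IHm !xpair_eqE; case: c {IHm} => /=; case: eqP => //= _; lia.
Qed.

Lemma row_ops_uniq k j m : uniq (row_ops k j m).
Proof.
elim: m j => //= m IHm j; rewrite inE !mem_row_ops IHm xpair_eqE /= eqxx /=.
by rewrite ltnn.
Qed.

Lemma mem_all_ops k m o :
  (o \in all_ops k m) = (k <= o.2.1 < o.2.2)%N && (o.2.2 < k + m)%N.
Proof.
case: o => c [k' j'] /=; elim: m k => [|m IHm] k /=; first by rewrite in_nil; lia.
rewrite mem_cat mem_row_ops IHm /=; lia.
Qed.

Lemma all_ops_uniq k m : uniq (all_ops k m).
Proof.
elim: m k => //= m IHm k; rewrite cat_uniq row_ops_uniq IHm andbT /=.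
apply/hasPn => o; rewrite mem_all_ops => o_in.
suff: o \notin row_ops k k.+1 m by [].
rewrite mem_row_ops; lia.
Qed.

Lemma sum_opdelta (c : nat -> nat) K o : (o.2.1 < K)%N -> (o.2.2 < K)%N ->
  \sum_(k < K) (c k)%:Z * opdelta o k <= (c o.2.1)%:Z - (c o.2.2)%:Z.
Proof.
move=> lt1 lt2.
have sum1 (x : int) m : (m < K)%N ->
    \sum_(k < K) ((c k)%:Z * (if k == m :> nat then x else 0)) = (c m)%:Z * x.
  move=> ltm; rewrite (bigD1 (Ordinal ltm)) //= eqxx big1 ?addr0 // => k neq.
  by rewrite ifN ?mulr0.
rewrite /opdelta; under eq_bigr do rewrite mulrBr.
by rewrite sumrB !sum1 //; case: (o.1); lia.
Qed.

(** The c-weight of beta is non-negative, and an operator at (i, j) lowers the c-weight by at least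
    c_j - c_i; the total loss cannot exceed the weight of alpha. *)
Lemma act_bound (d : opmon2) (alpha : iseq) (c : nat -> nat) K
    (beta := act_mon lower_op d.1 (act_mon raise_op d.2 alpha)) :
  (forall k, 0 <= beta@_k) ->
  (forall o, o \in opsupp d -> (o.2.1 < K)%N && (o.2.2 < K)%N) ->
  \sum_(o <- opsupp d) ((c o.2.2)%:Z - (c o.2.1)%:Z) *+ opexp d o <=
  \sum_(k < K) (c k)%:Z * alpha@_(k : nat).
Proof.
move=> beta_ge0 ltK.
have : 0 <= \sum_(k < K) (c k)%:Z * beta@_(k : nat).
  by apply: sumr_ge0 => k _; rewrite mulr_ge0.
under eq_bigr do rewrite act_coef mulrDr mulr_sumr.
rewrite big_split exchange_big /= -lerBlDr sub0r; apply: le_trans.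
rewrite -sumrN big_seq [leRHS]big_seq; apply: ler_sum => o /ltK/andP[lt1 lt2].
under eq_bigr do rewrite mulrnAr.
rewrite sumrMnl -mulNrn lerMn2r; apply/orP; right.
by rewrite -[leLHS]opprB lerN2 sum_opdelta.
Qed.

(* Apply act_bound with c k = k + 1 - n (truncated) and with c k = k + 1. *)
Lemma opexp_bound (d : opmon2) (alpha : iseq) n o
    (beta := act_mon lower_op d.1 (act_mon raise_op d.2 alpha)) :
  on_increasing_pairs d.1 -> on_increasing_pairs d.2 ->
  (forall k, (n <= k)%N -> alpha@_k = 0) -> (forall k, 0 <= beta@_k) ->
  o \in opsupp d ->
  [&& (o.2.1 < o.2.2)%N, (o.2.2 < n)%N &
      (opexp d o)%:Z <= wt n (fun k => alpha@_k)].
Proof.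
move=> inc1 inc2 alpha0 beta_ge0 o_in.
have incr o' : o' \in opsupp d -> (o'.2.1 < o'.2.2)%N.
  rewrite mem_cat => /orP[] /mapP[p p_in ->]; [exact: inc1 | exact: inc2].
pose K := (\max_(o' <- opsupp d) o'.2.2.+1 + n)%N.
have ltK o' : o' \in opsupp d -> (o'.2.1 < K)%N && (o'.2.2 < K)%N.
  move=> o'_in; have lt2 : (o'.2.2 < K)%N.
    by rewrite ltn_addr // (big_rem o') //= leq_max leqnn.
  by rewrite lt2 (ltn_trans (incr _ o'_in)).
have term_le (c : nat -> nat) : {homo c : x y / (x <= y)%N} ->
    ((c o.2.2)%:Z - (c o.2.1)%:Z) *+ opexp d o <=
    \sum_(k < K) (c k)%:Z * alpha@_(k : nat).
  move=> c_homo; apply: le_trans (act_bound c beta_ge0 ltK).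
  rewrite (big_rem o) //= lerDl big_seq; apply: sumr_ge0 => o' /mem_rem o'_in.
  by rewrite mulrn_wge0 // subr_ge0 lez_nat c_homo // ltnW ?incr.
rewrite incr //=; apply/andP; split.
  (* This weight vanishes below n and alpha vanishes from n on, so the bound is 0, whereas an
     operator reaching a position j >= n would lose at least 1. *)
  have := term_le (fun k => k.+1 - n)%N; rewrite big1 => [|k _]; last first.
    have [/alpha0 ->|ltkn] := leqP n k; first by rewrite mulr0.
    by rewrite (eqP (ltkn : k.+1 - n == 0)%N) mul0r.
  have exp_gt0 : (0 < opexp d o)%N by rewrite lt0n -mem_opsupp.
  move=> /(_ (fun x y lexy => leq_sub2r n (lexy : (x.+1 <= y.+1)%N))).
  rewrite pmulrn_lle0 //=; have := incr _ o_in; by move: (o.2.1) (o.2.2); lia.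
have := term_le succn (fun x y lexy => lexy).
rewrite /wt (_ : K = n + (K - n))%N; last by rewrite /K; lia.
rewrite big_split_ord /= [X in _ <= _ + X]big1 ?addr0 => [|k _]; last first.
  by rewrite alpha0 ?mulr0 // leq_addr.
apply: le_trans; have := incr _ o_in; move: (o.2.1) (o.2.2) (opexp d o) => x y s ltxy.
rewrite -natz ler_wMn2r //; lia.
Qed.

(** * The defining sum over all monomials as a product of B's *)

Section IndexSequences.
Variables (R : comNzRingType) (A : comAlgType R) (v : int -> A).
Hypothesis v_0 : v 0 = 1.
Hypothesis v_lt0 : forall n : int, n < 0 -> v n = 0.

Definition vprod (beta : iseq) : A := \prod_(k <- msupp beta) v (beta@_k).

Lemma vprod_neg (beta : iseq) k : beta@_k < 0 -> vprod beta = 0.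
Proof.
move=> lt0; have k_in : k \in msupp beta by rewrite -mcoeff_neq0 lt_eqF.
by rewrite /vprod (big_rem k) //= v_lt0 ?mul0r.
Qed.

Lemma vprodE (beta : iseq) n : (forall k, (n <= k)%N -> beta@_k = 0) ->
  vprod beta = prefix_prod v n (fun k => beta@_k).
Proof.
move=> beta0; rewrite /vprod /prefix_prod -(big_mkord xpredT (fun k => v (beta@_k))).
rewrite [RHS](bigID (mem (msupp beta))) /= [X in _ = _ * X]big1 ?mulr1; last first.
  by move=> k /mcoeff_outdom ->; exact: v_0.
rewrite -[RHS]big_filter; apply: perm_big; apply: uniq_perm => [||k].
- exact: fset_uniq.
- by rewrite filter_uniq ?iota_uniq.
rewrite mem_filter mem_index_iota /=; case: (boolP (k \in msupp beta)) => //.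
rewrite -mcoeff_neq0 /= => neq0; apply/esym; rewrite ltnNge.
by apply: contra neq0 => /beta0 ->.
Qed.

Variables (t theta : R) (h : nat -> R) (sh : {rmorphism A -> {poly A}}).
Hypothesis v_gen : generated_by v.
Hypothesis h_0 : h 0 = 1.
Hypothesis h_1 : h 1 = t - 1.
Hypothesis h_SS : forall k, h k.+2 = t * h k.+1.
Hypothesis sh_is : is_shift v h sh.

Definition Bprod (l : seq int) : A := Bcomp theta v sh_is.1 l 1.

Lemma sum_opmon_Bprod (cf : opmon2 -> R) (alpha : iseq) n :
  (forall d, cf d = \prod_(o <- opsupp d) opcoef theta h o (opexp d o)) ->
  (forall k, (n <= k)%N -> alpha@_k = 0) ->
  \sum_(d \in [set d : opmon * opmon |
                on_increasing_pairs d.1 /\ on_increasing_pairs d.2])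
     cf d *: vprod (act_mon lower_op d.1 (act_mon raise_op d.2 alpha)) =
  Bprod (slice (fun k => alpha@_k) 0 n).
Proof.
(* No exponent of a nonzero term exceeds w; the absolute value covers negative w. *)
move=> cfE alpha0; pose w := wt n (fun k => alpha@_k); pose N := (`|w|.+1)%N.
have ops_uniq := all_ops_uniq 0 n.
have [_ sum_all] := sums_to_all theta sh_is.1 v_lt0
  (is_shift_rel sh_is h_0 h_1 h_SS)
  (fun x i j => shiftC v_gen x i j sh_is sh_is)
  h_0 h_1 h_SS 0 n N.
have lt_wN : w < N%:Z by rewrite /N; lia.
have {}sum_all := sum_all (fun k => alpha@_k) lt_wN.
rewrite /prefix_prod big_ord0 mul1r -/(Bprod _) in sum_all; rewrite sum_all.
rewrite -op_sum_dops //.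
have in_dops d : d \in dops N (all_ops 0 n) ->
    (forall o, o \notin all_ops 0 n -> opexp d o = 0%N) /\
    (on_increasing_pairs d.1 /\ on_increasing_pairs d.2).
  move=> /(dopsP _ _ ops_uniq)[out _]; split=> //.
  have supp_in o : opexp d o != 0%N -> (o.2.1 < o.2.2)%N.
    by move=> nz; have := contra_neqN (out o) nz;
       rewrite negbK mem_all_ops => /andP[/andP[_ ->]].
  split=> p; rewrite mem_finsupp; first exact: (supp_in (true, p)).
  exact: (supp_in (false, p)).
rewrite (fsbigE (dops N (all_ops 0 n))) ?dops_uniq //; first last.
- move=> d [inc1 inc2] d_notin.
  pose beta := act_mon lower_op d.1 (act_mon raise_op d.2 alpha).
  (* A monomial outside the finite list must create a negative entry, for otherwise [opexp_bound]
     would place it in the list. *)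
  have [beta_ge0 | /existsNP[k /negP]] := pselect (forall k, 0 <= beta@_k); last first.
    by rewrite -ltNge => /vprod_neg ->; rewrite scaler0.
  case/negP: d_notin; apply/(dopsP _ _ ops_uniq).
  have bound := opexp_bound inc1 inc2 alpha0 beta_ge0.
  split=> o; rewrite mem_all_ops add0n leq0n /=.
    by move=> o_notin; apply/eqP; rewrite -[_ == _]negbK -mem_opsupp;
       apply: contra o_notin => /bound /and3P[-> ->].
  have [/eqP -> // | ] := boolP (opexp d o == 0%N).
  by rewrite -mem_opsupp => /bound /and3P[_ _ le_w] _; rewrite -/w in le_w; lia.
- by move=> d /in_dops[_ inc].
rewrite big_mkcond; apply: eq_big_seq => d /in_dops[out inc].
rewrite mem_set // cfE (@big_opsupp _ _ _ d (all_ops 0 n)) //; last first.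
  by move=> o; rewrite /opcoef h_0 mulr1.
congr (_ *: _); rewrite (@vprodE _ n) => [|k lenk]; last first.
  rewrite act_coef alpha0 // add0r big_seq big1 // => o.
  rewrite mem_opsupp => nz; have := contra_neqN (out o) nz.
  rewrite negbK mem_all_ops /opdelta => /andP[/andP[_ lt12] ltn].
  by rewrite !gtn_eqF ?subrr ?mul0rn //; move: (o.2.1) (o.2.2) lt12 ltn => x y; lia.
rewrite /prefix_prod add0n; apply: eq_bigr => k _; congr v.
rewrite act_coef (@big_opsupp _ _ _ d (all_ops 0 n) (fun o s => opdelta o k *+ s)) //.
Qed.

End IndexSequences.

(** * Horizontal strips *)

Fixpoint part_of (ms : seq nat) : seq nat :=
  if ms is m :: ms' then nseq m (size ms) ++ part_of ms' else [::].

Fixpoint mults (M : nat) (l : seq nat) : seq nat :=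
  if M is M'.+1 then count_mem M l :: mults M' l else [::].

(** Words run downwards from column M, so a bit's column is the length of the suffix it starts;
    columns beyond the word read as false. *)
Fixpoint sbit (s : seq bool) (i : nat) : bool :=
  if s is b :: s' then if i == size s then b else sbit s' i else false.

Fixpoint strip_ok (eps : bool) (ms : seq nat) (s : seq bool) : bool :=
  if ms is m :: ms' then
    if s is b :: s' then (b <= m + eps)%N && strip_ok b ms' s' else true
  else true.

Lemma size_mults M l : size (mults M l) = M.
Proof. by elim: M => //= M ->. Qed.

Lemma strip_weight_ok (R : nzRingType) (t : R) eps ms s :
  ~~ strip_ok eps ms s -> strip_weight t eps ms s = 0.
Proof.
elim: ms eps s => [|m ms IHms] eps [|b s] //=.
rewrite negb_and => /orP[|/IHms ->]; last by rewrite mulr0.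
by case: b eps m => [] [] [|m]; rewrite //= subrr mul0r.
Qed.

Lemma part_of_le ms : all (fun x => x <= size ms)%N (part_of ms).
Proof.
elim: ms => //= m ms IHms; rewrite all_cat all_nseq leqnn orbT /=.
by apply: sub_all IHms => x /leqW.
Qed.

Lemma conj_part_of m ms i : conj_part (part_of (m :: ms)) i =
  ((if i <= (size ms).+1 then m else 0) + conj_part (part_of ms) i)%N.
Proof. by rewrite /conj_part count_cat count_nseq; case: leqP; rewrite ?mul1n. Qed.

Lemma conj_gt l i M : all (fun x => x <= M)%N l -> (M < i)%N -> conj_part l i = 0%N.
Proof.
move=> leM lt_Mi; apply/eqP; rewrite eqn0Ngt -has_count.
apply/hasPn => x /(allP leM) lex.
by rewrite -ltnNge (leq_ltn_trans lex).
Qed.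

Lemma is_part_of ms : is_part (part_of ms).
Proof.
have geq_trans : transitive geq by move=> x y z /= lexy leyz; apply: leq_trans lexy.
apply/andP; split; last first.
  elim: ms => //= m ms IHms; rewrite mem_cat negb_or IHms andbT.
  by apply/negP => /nseqP[].
rewrite sorted_pairwise //; elim: ms => //= m ms IHms; rewrite pairwise_cat IHms andbT.
apply/andP; split.
  apply/allrelP => x y /nseqP[-> _] y_in; apply: leqW.
  exact: (allP (part_of_le ms)).
by elim: m => //= m ->; rewrite andbT all_nseq /= leqnn orbT.
Qed.

(** Both sides say that the box in row k (counted from 0) and column i lies in l. *)
Lemma ltn_conj_part l i k : is_part l -> (0 < i)%N ->
  (k < conj_part l i)%N = (i <= nth 0 l k)%N.
Proof.
case/andP=> sorted_l _ i_gt0; elim: l k sorted_l => [|x l IHl] k /=.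
  by rewrite nth_nil /conj_part /= [RHS]leqNgt i_gt0 ltn0.
move=> path_l; have x_max : all (fun y => y <= x)%N l.
  by apply: order_path_min path_l => y1 y2 y3 /= le1 le2; apply: leq_trans le1.
rewrite /conj_part /= -/(conj_part l i); case: (leqP i x) => [leix|ltxi].
  by case: k => [|k] //=; rewrite add1n ltnS IHl // (path_sorted path_l).
rewrite add0n (conj_gt x_max ltxi) ltn0; apply/esym/negbTE; rewrite -ltnNge.
case: k => [|k] //=; apply: leq_ltn_trans ltxi.
have [ltk | /(nth_default 0%N) ->] := ltnP k (size l); last by [].
by apply: (allP x_max); apply: mem_nth.
Qed.

Lemma part_conj_inj l n : is_part l -> is_part n ->
  (forall i, (0 < i)%N -> conj_part l i = conj_part n i) -> l = n.
Proof.
move=> l_part n_part eq_conj.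
have size_conj p : is_part p -> size p = conj_part p 1.
  case/andP=> _ p0; apply/esym/eqP; rewrite -all_count; apply/allP => x x_in.
  by rewrite lt0n; apply: contraNneq p0 => <-.
apply: (@eq_from_nth _ 0%N) => [|k _]; first by rewrite !size_conj ?eq_conj.
apply/eqP; rewrite eqn_leq; apply/andP; split.
  case eqi: (nth 0%N l k) => [|i] //.
  by rewrite -ltn_conj_part // -eq_conj // ltn_conj_part // eqi.
case eqi: (nth 0%N n k) => [|i] //.
by rewrite -ltn_conj_part // eq_conj // ltn_conj_part // eqi.
Qed.

Lemma part_leP l n : is_part l -> is_part n ->
  part_le n l <-> (forall i, (0 < i)%N -> (conj_part n i <= conj_part l i)%N).
Proof.
move=> l_part n_part; split=> [le_nl i i_gt0 | le_conj k].
  rewrite leqNgt; apply/negP; rewrite ltn_conj_part // => le_i.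
  have := leq_trans le_i (le_nl _).
  by rewrite -ltn_conj_part // ltnn.
case eqi: (nth 0%N n k) => [|i] //; rewrite -ltn_conj_part //.
by apply: leq_trans (le_conj _ _); rewrite // ltn_conj_part // eqi.
Qed.

Lemma conj_part_S l i : conj_part l i = (count_mem i l + conj_part l i.+1)%N.
Proof.
rewrite /conj_part; elim: l => //= x l ->; rewrite addnACA; congr (_ + _)%N.
by rewrite eq_sym leq_eqVlt; case: ltngtP.
Qed.

Lemma conj_mults M l i : (0 < i)%N ->
  conj_part (part_of (mults M l)) i = count (fun x => i <= x <= M)%N l.
Proof.
move=> i_gt0; elim: M => [|M IHM].
  by rewrite /conj_part /= (eq_count (a2 := pred0)) ?count_pred0 // => x /=; lia.
rewrite [mults _ _]/= conj_part_of IHM size_mults.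
elim: l {IHM} => [|x l IHl] /=; first by case: ifP.
by rewrite -{}IHl; case: (leqP i M.+1); case: (eqVneq x M.+1); lia.
Qed.

Lemma multsK M l : is_part l -> all (fun x => x <= M)%N l -> part_of (mults M l) = l.
Proof.
move=> l_part leM; apply: part_conj_inj => // [|i i_gt0]; first exact: is_part_of.
by rewrite conj_mults //; apply: eq_in_count => x /(allP leM) ->; rewrite andbT.
Qed.

Lemma sbit_gt s i : (size s < i)%N -> sbit s i = false.
Proof. by elim: s => //= b s IHs lt; rewrite gtn_eqF // IHs //; lia. Qed.

Lemma sbit_inj s s' : size s = size s' ->
  (forall i, (0 < i <= size s)%N -> sbit s i = sbit s' i) -> s = s'.
Proof.
elim: s s' => [|b s IHs] [|b' s'] //= [eq_size] eq_bit.
have := eq_bit (size s).+1; rewrite ltnSn /= eq_size eqxx => -> //.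
congr cons; apply: IHs => // i /andP[i_gt0 lei]; have := eq_bit i.
by rewrite i_gt0 leqW // -eq_size ltn_eqF //= => ->.
Qed.

(** The multiplicity of j changes by s_(j+1) - s_j, which telescopes over j >= i to eps - s_i. With
    eps true, the columns with s_i = 0 gain a box: removal by s is addition of the complementary
    strip. *)
Lemma conj_remove eps ms s i : size s = size ms -> strip_ok eps ms s ->
  (0 < i <= size ms)%N ->
  (conj_part (part_of (strip_remove eps ms s)) i + sbit s i =
   conj_part (part_of ms) i + eps)%N.
Proof.
elim: ms eps s => [|m ms IHms] eps [|b s] //=; first by case: i.
case=> eq_size /andP[le_b ok] /andP[i_gt0 lei].
rewrite -!/(part_of (_ :: _)) (conj_part_of (_ - _)) (conj_part_of m).
rewrite size_strip_remove // eq_size lei.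
case: eqP => [eqi|/eqP neq].
  rewrite !(conj_gt (part_of_le _)) ?size_strip_remove ?eqi //; lia.
have := IHms b s eq_size ok; rewrite i_gt0 /= => /(_ _); lia.
Qed.

Lemma sumn_remove eps ms s : size s = size ms -> strip_ok eps ms s ->
  (sumn (part_of (strip_remove eps ms s)) + count id s =
   sumn (part_of ms) + eps * size ms)%N.
Proof.
elim: ms eps s => [|m ms IHms] eps [|b s] //=; first by rewrite muln0.
case=> eq_size /andP[le_b ok]; rewrite !sumn_cat !sumn_nseq size_strip_remove //.
have := IHms b s eq_size ok; nia.
Qed.

(** The offset e belongs to the whole word and stays fixed in the recursion, while eps is replaced
    by the bit of the current column. *)
Lemma strip_remove_mults eps e M s l n : size s = M ->
  (forall i, (0 < i <= M.+1)%N ->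
     (conj_part n i + sbit (eps :: s) i = conj_part l i + e)%N) ->
  strip_remove eps (mults M l) s = mults M n /\ strip_ok eps (mults M l) s.
Proof.
elim: M eps s => [|M IHM] eps [|b s] //= [eq_size] eq_conj.
have eq1 := eq_conj M.+1 (leqnSn M.+1); have eq2 := eq_conj M.+2 (leqnn M.+2).
rewrite eq_size /= !eqxx ltn_eqF //= in eq1 eq2.
have := conj_part_S l M.+1; have := conj_part_S n M.+1 => eqn eql.
have [|-> ->] := IHM b s eq_size.
  move=> i /andP[i_gt0 lei]; have := eq_conj i; rewrite i_gt0 leqW // eq_size.
  by rewrite [i == M.+2]ltn_eqF ?ltnS //= eq_size => ->.
move: eq1 eq2 eqn eql.
move: (conj_part n _) (conj_part n _) (conj_part l _) (conj_part l _).
move: (count _ _) (count _ _) => c1 c2 d1 d2 d3 d4 e1 e2 e3 e4.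
split; last by rewrite andbT; lia.
congr cons; lia.
Qed.

Lemma count_part_of m ms i : count_mem i (part_of (m :: ms)) =
  ((if i == (size ms).+1 then m else 0) + count_mem i (part_of ms))%N.
Proof. by rewrite /= count_cat count_nseq /= eq_sym; case: eqP; rewrite ?mul1n. Qed.

Lemma count_gt (l : seq nat) i M :
  all (fun x => x <= M)%N l -> (M < i)%N -> count_mem i l = 0%N.
Proof.
move=> leM ltMi; apply/count_memPn; apply/negP => /(allP leM).
by rewrite leqNgt ltMi.
Qed.

Lemma strip_weight_prod (R : nzRingType) (t : R) eps ms s : size s = size ms ->
  strip_weight t eps ms s = \prod_(i <- rev (iota 1 (size ms)))
    (if sbit (eps :: s) i && ~~ sbit (eps :: s) i.+1
     then 1 - t ^+ count_mem i (part_of ms) else 1).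
Proof.
elim: ms eps s => [|m ms IHms] eps [|b s] //; first by rewrite big_nil.
move=> [eq_size]; rewrite [size (m :: ms)]/= -[(size ms).+1]addn1 iotaD add1n.
rewrite cats1 rev_rcons big_cons /= !eq_size !eqxx ltn_eqF //=; congr (_ * _).
  by rewrite count_part_of eqxx (count_gt (part_of_le _)) ?addn0.
rewrite IHms // big_seq [RHS]big_seq; apply: eq_bigr => i.
rewrite mem_rev mem_iota add1n => /andP[i_gt0 lti].
rewrite (count_part_of m) (ltn_eqF lti) add0n.
by rewrite /= eq_size (ltn_eqF (leqW lti)) ?(ltn_eqF lti) [i.+1 == (size ms).+2]ltn_eqF.
Qed.

Lemma fsbig_sub (T : Type) (idx : T) (op : Monoid.com_law idx) (I : choiceType)
    (D : set I) (r : seq I) (F : I -> T) : uniq r -> (forall i, D i -> i \in r) ->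
  \big[op/idx]_(i \in D) F i = \big[op/idx]_(i <- r | i \in D) F i.
Proof.
move=> uniq_r sub; rewrite [RHS]bigfs ?set_mem_set // => i /set_mem /sub ->.
by [].
Qed.

Lemma fsbig_reindex_seq (T : Type) (idx : T) (op : Monoid.com_law idx) (I : choiceType)
    (J : eqType) (D : set I) (r : seq J) (f : J -> I) (F : I -> T) :
  uniq r -> {in r &, injective f} -> (forall j, j \in r -> D (f j)) ->
  (forall i, D i -> exists2 j, j \in r & f j = i) ->
  \big[op/idx]_(i \in D) F i = \big[op/idx]_(j <- r) F (f j).
Proof.
move=> uniq_r inj_f fD Df; rewrite (fsbig_sub op (r := [seq f j | j <- r])).
- rewrite big_map big_mkcond /=; apply: eq_big_seq => j /fD Dj.
  by rewrite mem_set.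
- by rewrite map_inj_in_uniq.
by move=> i /Df[j j_in <-]; apply: map_f.
Qed.

Lemma sum_strip_weight_ok (R : nzRingType) (V : lmodType R) (t : R) eps ms
    (P : pred (seq bool)) (F : seq nat -> V) :
  \sum_(s <- bit_words (size ms) | P s)
     strip_weight t eps ms s *: F (strip_remove eps ms s) =
  \sum_(s <- [seq s <- bit_words (size ms) | P s && strip_ok eps ms s])
     strip_weight t eps ms s *: F (strip_remove eps ms s).
Proof.
rewrite big_filter big_mkcondr; apply: eq_bigr => s _.
by case: ifP => // /negbT /strip_weight_ok ->; rewrite scale0r.
Qed.

Definition strip_phi (R : comNzRingType) (t : R) (l n : seq nat) : R :=
  \big[*%R/1]_(i \in strip_I l n) (1 - t ^+ mult_part l i).

Definition strip_psi (R : comNzRingType) (t : R) (l n : seq nat) : R :=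
  \big[*%R/1]_(j \in strip_J l n) (1 - t ^+ mult_part n j).

Lemma hstripP r n l : is_part n -> is_part l ->
  hstrip r n l <->
  (forall i, (0 < i)%N -> (conj_part n i <= conj_part l i <= (conj_part n i).+1)%N) /\
  sumn l = (sumn n + r)%N.
Proof.
move=> n_part l_part; split.
  case=> /(part_leP l_part n_part) le_conj sum_l col; split=> // i i_gt0.
  rewrite le_conj //=; have := col i i_gt0; rewrite /strip_col.
  by move: (conj_part _ _) (conj_part _ _); lia.
case=> col sum_l; split=> // [|i i_gt0].
  by apply/(part_leP l_part n_part) => i /col /andP[].
have := col i i_gt0; rewrite /strip_col.
by move: (conj_part _ _) (conj_part _ _); lia.
Qed.

Lemma strip_remove_inj eps ms s s' : size s = size ms -> size s' = size ms ->
  strip_ok eps ms s -> strip_ok eps ms s' ->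
  part_of (strip_remove eps ms s) = part_of (strip_remove eps ms s') -> s = s'.
Proof.
move=> eq_s eq_s' ok ok' eq_part; apply: sbit_inj; first by rewrite eq_s'.
rewrite eq_s => i lei; have := conj_remove eq_s ok lei; rewrite eq_part.
have := conj_remove eq_s' ok' lei; move: (conj_part _ _) (conj_part _ _).
by case: (sbit s i); case: (sbit s' i); lia.
Qed.

Fixpoint mkbits M (p : pred nat) : seq bool :=
  if M is M'.+1 then p M :: mkbits M' p else [::].

Lemma size_mkbits M p : size (mkbits M p) = M.
Proof. by elim: M => //= M ->. Qed.

Lemma sbit_mkbits M p i : (0 < i <= M)%N -> sbit (mkbits M p) i = p i.
Proof.
elim: M => [|M IHM] /=; first by case: i.
rewrite size_mkbits => /andP[i_gt0 lei]; case: eqP => [-> //|/eqP neq].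
by apply: IHM; rewrite i_gt0 -ltnS ltn_neqAle neq.
Qed.

Section StripSums.
Variables (R : comNzRingType) (V : lmodType R) (t : R) (F : seq nat -> V).

Lemma strip_phi_weight xi lam M s : is_part xi -> all (fun x => x <= M)%N xi ->
  size s = M ->
  (forall i, (0 < i)%N -> strip_col xi lam i = (sbit (false :: s) i)%:Z) ->
  strip_weight t false (mults M xi) s = strip_phi t xi lam.
Proof.
move=> xi_part leM size_s col; rewrite strip_weight_prod ?size_mults // multsK //.
rewrite /strip_phi (fsbig_sub _ (r := rev (iota 1 M))); first last.
- move=> i [i_gt0 col1 _]; rewrite mem_rev mem_iota i_gt0 add1n ltnS leqNgt.
  by apply/negP => ltMi; move: col1; rewrite col //= sbit_gt ?size_s // if_same.
- by rewrite rev_uniq iota_uniq.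
rewrite [RHS]big_mkcond; apply: eq_big_seq => i; rewrite mem_rev mem_iota add1n.
case/andP=> i_gt0 lti; congr (if _ then _ else _); apply/idP/idP.
  case/andP=> b0 b1; apply: mem_set; split=> //; rewrite col ?b0 //.
  by rewrite (negPf b1).
by move=> /set_mem[_]; rewrite !col //; case: sbit => //; case: sbit.
Qed.

(** In the complementary word a set bit at i with an unset bit at i + 1 marks exactly an element i
    of J, so the rule that gives phi now gives psi. *)
Lemma strip_psi_weight xi mu M s : is_part mu -> all (fun x => x <= M)%N mu ->
  size s = M ->
  (forall i, (0 < i <= M.+1)%N -> strip_col xi mu i = (~~ sbit (true :: s) i)%:Z) ->
  (forall i, (M < i)%N -> strip_col xi mu i = 0) ->
  strip_weight t true (mults M mu) s = strip_psi t xi mu.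
Proof.
move=> mu_part leM size_s col col0; rewrite strip_weight_prod ?size_mults // multsK //.
rewrite /strip_psi (fsbig_sub _ (r := rev (iota 1 M))); first last.
- move=> i [i_gt0 _ col1]; rewrite mem_rev mem_iota i_gt0 add1n ltnS leqNgt.
  by apply/negP => ltMi; move: col1; rewrite col0 // ltnW.
- by rewrite rev_uniq iota_uniq.
rewrite [RHS]big_mkcond; apply: eq_big_seq => i; rewrite mem_rev mem_iota add1n.
case/andP=> i_gt0 lti; congr (if _ then _ else _); apply/idP/idP.
  case/andP=> b0 b1; apply: mem_set; split=> //; rewrite col ?b0 ?b1 //.
  by rewrite i_gt0 ltnW.
move=> /set_mem[_]; rewrite !col ?i_gt0 ?(ltnW lti) //.
by case: sbit => //; case: sbit.
Qed.

(** Legal words with r set bits correspond to the strips; all other words with r set bits have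
    weight 0. *)
Lemma sum_hstrip_down xi M r : is_part xi -> all (fun x => x <= M)%N xi ->
  \sum_(lam \in [set lam | is_part lam /\ hstrip r lam xi]%classic)
     strip_phi t xi lam *: F lam =
  \sum_(s <- bit_words M | count id s == r)
     strip_weight t false (mults M xi) s *:
       F (part_of (strip_remove false (mults M xi) s)).
Proof.
move=> xi_part leM; pose ms := mults M xi.
pose f s := part_of (strip_remove false ms s).
have size_ms : size ms = M by rewrite size_mults.
have part_ms : part_of ms = xi by apply: multsK.
pose r' := [seq s <- bit_words M | (count id s == r) && strip_ok false ms s].
have r'P s : s \in r' -> [/\ size s = M, count id s = r, strip_ok false ms s &
    forall i, (0 < i)%N -> (conj_part (f s) i + sbit s i = conj_part xi i)%N].
  rewrite mem_filter mem_bit_words => /andP[/andP[/eqP cnt ok] /eqP size_s].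
  split=> // i i_gt0; have [lei | lti] := leqP i M.
    by rewrite conj_remove ?size_ms ?size_s ?i_gt0 // part_ms addn0.
  rewrite sbit_gt ?size_s // (conj_gt leM) // (conj_gt (part_of_le _)) //.
  by rewrite size_strip_remove ?size_ms.
have psum := sum_strip_weight_ok t false ms (fun s => count id s == r) (F \o part_of).
rewrite size_ms -/r' /= in psum; rewrite [RHS]psum.
rewrite (fsbig_reindex_seq _ (r := r') (f := f)).
- apply: eq_big_seq => s /r'P[size_s _ _ conj_s]; congr (_ *: _).
  apply/esym/strip_phi_weight => // i i_gt0.
  have [->|neq] := eqVneq i (size s).+1.
    rewrite /= eqxx /strip_col -!conj_s // sbit_gt // addn0 subrr //.
  by rewrite /= (negPf neq) /strip_col -conj_s // PoszD addrAC subrr add0r.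
- by rewrite filter_uniq ?bit_words_uniq.
- move=> s s' /r'P[size_s _ ok _] /r'P[size_s' _ ok' _].
  by apply: strip_remove_inj; rewrite ?size_ms.
- move=> s /r'P[size_s cnt ok conj_s]; split; first exact: is_part_of.
  apply/hstripP => //; first exact: is_part_of.
  split=> [i i_gt0|]; first by rewrite -conj_s //; case: (sbit s i); lia.
  by rewrite -cnt sumn_remove ?size_ms // part_ms addn0.
move=> lam [lam_part /(hstripP _ lam_part xi_part)[col sum_lam]].
pose s := mkbits M (fun i => conj_part xi i != conj_part lam i).
have lam_le : all (fun x => x <= M)%N lam.
  apply/allP => x x_in; rewrite leqNgt; apply/negP => ltMx.
  have := col x; rewrite (leq_ltn_trans _ ltMx) // (conj_gt leM ltMx) => /(_ isT).
  by rewrite leqn0 eqn0Ngt -has_count => /andP[/hasPn /(_ x x_in)]; rewrite leqnn.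
have [|eq_remove ok] := @strip_remove_mults false 0 M s xi lam (size_mkbits _ _).
  move=> i /andP[i_gt0 lei]; rewrite /= size_mkbits addn0.
  have [->|neq] := eqVneq i M.+1; first by rewrite !(@conj_gt _ _ M).
  rewrite sbit_mkbits; last by rewrite i_gt0 -ltnS ltn_neqAle neq.
  by have := col i i_gt0; case: eqP; lia.
have fs : f s = lam by rewrite /f eq_remove multsK.
exists s => //; rewrite mem_filter mem_bit_words size_mkbits eqxx andbT ok andbT.
have := @sumn_remove false ms s; rewrite size_ms size_mkbits => /(_ erefl ok).
rewrite -/(f s) fs part_ms addn0 sum_lam => /eqP; by rewrite eqn_add2l.
Qed.

Lemma part_le_sumn (n l : seq nat) : part_le n l -> (sumn n <= sumn l)%N.
Proof.
elim: n l => //= x n IHn l le_nl; have := le_nl 0%N.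
case: l le_nl => [|y l] le_nl /= le0.
  have /IHn /= : part_le n [::] by move=> k; have := le_nl k.+1; rewrite !nth_nil.
  by lia.
by apply: leq_add => //; apply: IHn => k; apply: (le_nl k.+1).
Qed.

Lemma part_le_head (n l : seq nat) : part_le n l ->
  (nth 0 l 0 + sumn n <= nth 0 n 0 + sumn l)%N.
Proof.
case: l => [|y l]; first by move/part_le_sumn => /=; lia.
case: n => [|x n] le_nl /=; first by lia.
by have := @part_le_sumn n l (fun k => le_nl k.+1); lia.
Qed.

(** Adding b boxes lengthens the first row by at most b, so M columns hold every xi. *)
Lemma hstrip_max b mu xi M : is_part mu -> is_part xi -> hstrip b mu xi ->
  all (fun x => x + b <= M)%N mu -> (b <= M)%N -> all (fun x => x <= M)%N xi.
Proof.
move=> mu_part xi_part [le_mx sum_xi _] mu_le le_bM.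
have head_mu : (nth 0 mu 0 + b <= M)%N by case: (mu) mu_le => [|x l] //= /andP[].
have head_xi : (nth 0 xi 0 <= M)%N by have := part_le_head le_mx; lia.
apply/allP => x x_in; rewrite leqNgt; apply/negP => ltMx.
have : (0 < conj_part xi M.+1)%N by rewrite -has_count; apply/hasP; exists x.
by rewrite ltn_conj_part // ltnNge head_xi.
Qed.

(* The word s marks the columns in 1..M that do NOT meet the strip xi - mu. *)
Lemma sum_hstrip_up mu M b :
  is_part mu -> all (fun x => x + b <= M)%N mu -> (b <= M)%N ->
  \sum_(xi \in [set xi | is_part xi /\ hstrip b mu xi]%classic)
     strip_psi t xi mu *: F xi =
  \sum_(s <- bit_words M | count id s == (M - b)%N)
     strip_weight t true (mults M mu) s *:
       F (part_of (strip_remove true (mults M mu) s)).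
Proof.
move=> mu_part leMb le_bM; pose ms := mults M mu.
pose f s := part_of (strip_remove true ms s).
have leM : all (fun x => x <= M)%N mu.
  by apply: sub_all leMb => x; apply: leq_trans; rewrite leq_addr.
have size_ms : size ms = M by rewrite size_mults.
have part_ms : part_of ms = mu by apply: multsK.
pose r' := [seq s <- bit_words M | (count id s == M - b)%N && strip_ok true ms s].
have r'P s : s \in r' -> [/\ size s = M, count id s = (M - b)%N, strip_ok true ms s &
    forall i, (0 < i <= M)%N -> (conj_part (f s) i + sbit s i = (conj_part mu i).+1)%N].
  rewrite mem_filter mem_bit_words => /andP[/andP[/eqP cnt ok] /eqP size_s].
  by split=> // i lei; rewrite conj_remove ?size_ms ?size_s // part_ms addn1.
have f_gt s i : size s = M -> (M < i)%N -> conj_part (f s) i = 0%N.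
  move=> size_s lti; rewrite (conj_gt (part_of_le _)) //.
  by rewrite size_strip_remove ?size_ms.
have psum :=
  sum_strip_weight_ok t true ms (fun s => count id s == M - b)%N (F \o part_of).
rewrite size_ms -/r' /= in psum; rewrite [RHS]psum.
rewrite (fsbig_reindex_seq _ (r := r') (f := f)).
- apply: eq_big_seq => s /r'P[size_s _ _ conj_s]; congr (_ *: _).
  apply/esym/strip_psi_weight => // i.
    case/andP=> i_gt0 lei; rewrite /strip_col.
    have [eqi|neq] := eqVneq i (size s).+1.
      by rewrite eqi /= eqxx f_gt ?(conj_gt leM) ?subrr // size_s.
    have := conj_s i; rewrite i_gt0 -ltnS ltn_neqAle -size_s neq size_s lei => /(_ isT).
    rewrite /= (negPf neq); move: (conj_part _ _) (conj_part _ _).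
    by case: (sbit s i); lia.
  by move=> ltMi; rewrite /strip_col f_gt // (conj_gt leM).
- by rewrite filter_uniq ?bit_words_uniq.
- move=> s s' /r'P[size_s _ ok _] /r'P[size_s' _ ok' _].
  by apply: strip_remove_inj; rewrite ?size_ms.
- move=> s /r'P[size_s cnt ok conj_s]; split; first exact: is_part_of.
  apply/hstripP => //; first exact: is_part_of.
  split=> [i i_gt0|].
    have [lei|lti] := leqP i M; last by rewrite f_gt // (conj_gt leM).
    have := conj_s i; rewrite i_gt0 lei => /(_ isT).
    by move: (conj_part _ _) (conj_part _ _); case: (sbit s i); lia.
  have := @sumn_remove true ms s; rewrite size_ms size_s => /(_ erefl ok).
  by rewrite part_ms cnt -/(f s); lia.
move=> xi [xi_part strip_xi].
have xi_le := hstrip_max mu_part xi_part strip_xi leMb le_bM.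
have [col sum_xi] := (hstripP b mu_part xi_part).1 strip_xi.
pose s := mkbits M (fun i => conj_part xi i == conj_part mu i).
have [|eq_remove ok] := @strip_remove_mults true 1 M s mu xi (size_mkbits _ _).
  move=> i /andP[i_gt0 lei]; rewrite /= size_mkbits.
  have [->|neq] := eqVneq i M.+1; first by rewrite !(@conj_gt _ _ M).
  rewrite sbit_mkbits; last by rewrite i_gt0 -ltnS ltn_neqAle neq.
  have := col i i_gt0; move: (conj_part _ _) (conj_part _ _) => x y.
  by case: eqP; lia.
have fs : f s = xi by rewrite /f eq_remove multsK.
exists s => //; rewrite mem_filter mem_bit_words size_mkbits eqxx andbT ok andbT.
have := @sumn_remove true ms s; rewrite size_ms size_mkbits => /(_ erefl ok).
by rewrite -/(f s) fs part_ms sum_xi => eq_sum; apply/eqP; lia.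
Qed.

End StripSums.

(** * The Pieri rule *)

Lemma leq_sumn (l : seq nat) : all (fun x => x <= sumn l)%N l.
Proof.
elim: l => //= x l IHl; rewrite leq_addr /=; apply: sub_all IHl => y ley.
by rewrite (leq_trans ley) ?leq_addl.
Qed.

Lemma finite_parts N : finite_set [set l | is_part l /\ (sumn l <= N)%N]%classic.
Proof.
(* A partition of size at most N is determined by N multiplicities, each at most N. *)
pose f (x : {ffun 'I_N -> 'I_N.+1}) := part_of [seq val (x i) | i <- enum 'I_N].
apply: (@sub_finite_set _ _ (f @` setT)%classic); last first.
  by apply: finite_image; apply: finite_finset.
move=> l [l_part sum_l]; have leN : all (fun x => x <= N)%N l.
  by apply: sub_all (leq_sumn l) => x /leq_trans ->.
exists [ffun i : 'I_N => inord (nth 0%N (mults N l) i)] => //.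
rewrite /f -[RHS](multsK l_part leN); congr part_of.
apply: (@eq_from_nth _ 0%N); rewrite size_map size_enum_ord ?size_mults // => i lti.
rewrite (nth_map (Ordinal lti)) ?size_enum_ord // ffunE /= nth_enum_ord // inordK //.
rewrite ltnS; have : nth 0%N (mults N l) i \in mults N l by rewrite mem_nth ?size_mults.
have : all (fun x => x <= N)%N (mults N l); last by move/allP=> h /h.
have count_le j : (0 < j)%N -> (count_mem j l <= N)%N.
  move=> j_gt0; apply: leq_trans sum_l; elim: (l) => //= x l' IHl'.
  by apply: leq_add => //; case: eqP => // ->.
by elim: {2}N => //= M ->; rewrite count_le.
Qed.

Lemma fsbig_pair_dep (T : Type) (idx : T) (op : Monoid.com_law idx) (I J : choiceType)
    (D : set I) (E : I -> set J) (F : I * J -> T) :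
  finite_set D -> (forall i, D i -> finite_set (E i)) ->
  \big[op/idx]_(p \in [set p | D p.1 /\ E p.1 p.2]%classic) F p =
  \big[op/idx]_(i \in D) \big[op/idx]_(j \in E i) F (i, j).
Proof.
move=> finD finE.
pose L := [seq (i, j) | i <- fset_set D, j <- fset_set (E i)].
rewrite (fsbig_reindex_seq op (r := L) (f := id)) //; first last.
- move=> [i j] /= [Di Eij]; exists (i, j) => //; apply/allpairsPdep; exists i, j.
  split=> //; first by rewrite in_fset_set // mem_set.
  by rewrite in_fset_set ?mem_set //; apply: finE.
- move=> p /allpairsPdep[i [j [i_in j_in ->]]] /=.
  move: i_in; rewrite in_fset_set // => /set_mem Di.
  by move: j_in; rewrite (in_fset_set (finE _ Di)) => /set_mem.
- apply: allpairs_uniq_dep => [|i _|]; rewrite ?fset_uniq //.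
  by move=> [i1 j1] [i2 j2] _ _ /= [-> ->].
rewrite big_allpairs_dep fsbig_finite //; apply: eq_big_seq => i.
by rewrite in_fset_set // => /set_mem /finE finEi; rewrite fsbig_finite.
Qed.

Lemma updown_finite_up mu b :
  finite_set [set xi | is_part xi /\ hstrip b mu xi]%classic.
Proof.
apply: sub_finite_set (finite_parts (sumn mu + b)) => xi [xi_part [_ sum_xi _]].
by split=> //; rewrite sum_xi.
Qed.

Lemma updown_finite_down xi a :
  finite_set [set lam | is_part lam /\ hstrip a lam xi]%classic.
Proof.
apply: sub_finite_set (finite_parts (sumn xi)) => lam [lam_part [_ sum_xi _]].
by split=> //; rewrite sum_xi leq_addr.
Qed.

Lemma updown_finite mu a b : finite_set (updown mu a b).
Proof.
have fin := finite_parts (sumn mu + b).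
apply: sub_finite_set (finite_setX fin fin) => p [xi_part lam_part].
case=> _ sum_lam _ [_ sum_mu _]; split; split=> //; rewrite -sum_mu //.
by rewrite sum_lam leq_addr.
Qed.

Lemma iseq_of_part_coef l k : (iseq_of_part l)@_k = (nth 0%N l k)%:Z.
Proof.
rewrite /iseq_of_part raddf_sum /=.
under eq_bigr do rewrite mcoeffU.
have [ltk | lek] := ltnP k (size l).
  rewrite (bigD1 (Ordinal ltk)) //= eqxx big1 ?addr0 // => i neq.
  by rewrite (_ : (i == k :> nat) = false) //; apply/negbTE.
rewrite nth_default // big1 // => i _.
by rewrite ltn_eqF // (leq_trans (ltn_ord i)).
Qed.

Section Pieri.
Variables (R : comNzRingType) (A : comAlgType R) (v : int -> A) (t theta : R).
Variables (c h : nat -> R) (sa sh : {rmorphism A -> {poly A}}).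
Hypothesis v_0 : v 0 = 1.
Hypothesis v_lt0 : forall n : int, n < 0 -> v n = 0.
Hypothesis v_gen : generated_by v.
Hypothesis A_char : forall x : A, x = - x -> x = 0.
Hypothesis c_0 : c 0 = 1.
Hypothesis c_1 : c 1 = 1 - t.
Hypothesis c_SS : forall k, c k.+2 = 1 * c k.+1.
Hypothesis h_0 : h 0 = 1.
Hypothesis h_1 : h 1 = t - 1.
Hypothesis h_SS : forall k, h k.+2 = t * h k.+1.
Hypothesis sa_is : is_shift v c sa.
Hypothesis sh_is : is_shift v h sh.

Definition Vpart (l : seq nat) : A := Bprod theta sh_is [seq Posz x | x <- l].

Let sa_rel := is_shift_rel sa_is c_0 c_1 c_SS.
Let sh_rel := is_shift_rel sh_is h_0 h_1 h_SS.
Let sa_shC x i j := shiftC v_gen x i j sa_is sh_is.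
Let sh_shC x i j := shiftC v_gen x i j sh_is sh_is.
Let sa_0 x := coef_shift0 v_gen x sa_is c_0.

Lemma Vmult_Vpart ms : Vmult theta v sh_is.1 ms = Vpart (part_of ms).
Proof.
elim: ms => //= m ms IHms; rewrite IHms /Vpart /Bprod /Bcomp map_cat foldr_cat.
by elim: m => //= m ->.
Qed.

Let strip_op_Vpart := strip_op_Vmult theta sa_is.1 sh_is.1 v_0 v_lt0 sa_rel sh_rel
  sa_shC sh_shC sa_0 A_char.

Lemma sa_Vpart xi r : is_part xi -> (sa (Vpart xi))`_r =
  \sum_(lam \in [set lam | is_part lam /\ hstrip r lam xi]%classic)
     strip_phi t xi lam *: Vpart lam.
Proof.
move=> xi_part; rewrite (sum_hstrip_down t _ _ xi_part (leq_sumn xi)).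
have := strip_op_Vpart false r (mults (sumn xi) xi).
rewrite size_mults /strip_op Vmult_Vpart multsK ?leq_sumn // => ->.
by apply: eq_bigr => s _; rewrite Vmult_Vpart.
Qed.

Lemma Zop_Vpart mu b : is_part mu -> Zop theta v sh b%:Z (Vpart mu) =
  \sum_(xi \in [set xi | is_part xi /\ hstrip b mu xi]%classic)
     strip_psi t xi mu *: Vpart xi.
Proof.
(* The first two summands make room for all strips on mu; the third puts M - b beyond the degree of
   [sa (Vpart mu)], as [Zop_Cop] requires. *)
move=> mu_part; pose M := (sumn mu + b + size (sa (Vpart mu)))%N.
have leMb : all (fun x => x + b <= M)%N mu.
  by apply: sub_all (leq_sumn mu) => x lex; rewrite /M -addnA leq_add ?leq_addr.
have leM : all (fun x => x <= M)%N mu.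
  by apply: sub_all leMb => x; apply: leq_trans; rewrite leq_addr.
have le_bM : (b <= M)%N by rewrite /M; lia.
rewrite (sum_hstrip_up t _ mu_part leMb le_bM).
have := strip_op_Vpart true (M - b) (mults M mu).
rewrite size_mults /strip_op Vmult_Vpart multsK // => strip_eq.
have := @Zop_Cop _ _ theta v sa sh sh_is.1 sa_shC sa_0 (fun x k => shift_inverse
   v_gen v_lt0 x k sa_is sh_is sa_rel sh_rel) b%:Z (M - b) (Vpart mu).
move=> <-; last by rewrite /M; lia.
rewrite -PoszD subnKC // strip_eq.
by apply: eq_bigr => s _; rewrite Vmult_Vpart.
Qed.

Lemma updown_sum mu a b (F : seq nat -> A) : is_part mu ->
  \sum_(p \in updown mu a b) (strip_phi t p.1 p.2 * strip_psi t p.1 mu) *: F p.2 =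
  \sum_(xi \in [set xi | is_part xi /\ hstrip b mu xi]%classic)
     strip_psi t xi mu *:
       \sum_(lam \in [set lam | is_part lam /\ hstrip a lam xi]%classic)
          strip_phi t xi lam *: F lam.
Proof.
move=> mu_part; have -> : updown mu a b =
    [set p | (is_part p.1 /\ hstrip b mu p.1) /\
             (is_part p.2 /\ hstrip a p.2 p.1)]%classic.
  by apply/seteqP; split=> p /=; [case=> ? ? ? ? | case=> [[? ?] [? ?]]].
rewrite (fsbig_pair_dep _ (D := [set xi | is_part xi /\ hstrip b mu xi]%classic)
  (E := fun xi => [set lam | is_part lam /\ hstrip a lam xi]%classic)); first last.
- by move=> xi _; apply: updown_finite_down.
- exact: updown_finite_up.
apply: eq_fsbigr => xi _ /=; rewrite !fsbig_finite ?scaler_sumr;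
  try exact: updown_finite_down.
by apply: eq_bigr => lam _; rewrite scalerA mulrC.
Qed.

Lemma v_Vpart mu r : is_part mu -> v r%:Z * Vpart mu =
  \sum_(a < r.+1) \sum_(i < (minn a (r - a)).+1)
     \sum_(p \in updown mu (a - i) (r - a - i))
        (theta ^+ a * (h i * (strip_phi t p.1 p.2 * strip_psi t p.1 mu))) *: Vpart p.2.
Proof.
move=> mu_part.
rewrite (@v_mul _ _ theta v sa sh v_lt0 (fun x k => shift_inverse
   v_gen v_lt0 x k sa_is sh_is sa_rel sh_rel)).
apply: eq_bigr => a _.
rewrite (Zop_a theta sa_is.1 sh_is.1 v_lt0 sa_rel sa_shC sa_0 h_0 h_1 h_SS) scaler_sumr.
apply: eq_bigr => i _; rewrite scalerA Zop_Vpart //.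
transitivity ((theta ^+ a * h i) *: \sum_(p \in updown mu (a - i) (r - a - i))
   (strip_phi t p.1 p.2 * strip_psi t p.1 mu) *: Vpart p.2).
  congr (_ *: _); rewrite updown_sum // fsbig_finite ?rmorph_sum ?coef_sum;
    last exact: updown_finite_up.
  rewrite fsbig_finite; last exact: updown_finite_up.
  apply: eq_big_seq => xi; rewrite in_fset_set; last exact: updown_finite_up.
  move=> /set_mem[xi_part _]; rewrite sa_is.1 coefZ mulr_algl.
  by rewrite sa_Vpart.
have fin := updown_finite mu (a - i) (r - a - i).
rewrite !fsbig_finite // scaler_sumr; apply: eq_bigr => p _.
by rewrite scalerA -!mulrA.
Qed.

(** The term i = 0 of [v_Vpart], where h 0 = 1, is split off as the first sum. The coefficients are
    parameters tied by equations, so that the theorem is an instance. *)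
Lemma opmon_pieri (cf : opmon * opmon -> R) (K0 : nat -> seq nat * seq nat -> R)
    (K : nat -> nat -> seq nat * seq nat -> R) (r : nat) (mu : seq nat)
    (W := fun alpha => \sum_(d \in [set d : opmon * opmon |
                on_increasing_pairs d.1 /\ on_increasing_pairs d.2]%classic)
     cf d *: vprod v (act_mon lower_op d.1 (act_mon raise_op d.2 alpha))) :
  (forall d, cf d = \prod_(o <- opsupp d) opcoef theta h o (opexp d o)) ->
  (forall a p, K0 a p = theta ^+ a * (strip_phi t p.1 p.2 * strip_psi t p.1 mu)) ->
  (forall a i p, (0 < i)%N -> K a i p =
     theta ^+ a * (h i * (strip_phi t p.1 p.2 * strip_psi t p.1 mu))) ->
  is_part mu ->
  W (iseq_of_part mu) * v r%:Z =
    \sum_(a < r.+1) \sum_(p \in updown mu a (r - a)) K0 a p *: W (iseq_of_part p.2)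
  + \sum_(a < r.+1) \sum_(1 <= i < (minn a (r - a)).+1)
      \sum_(p \in updown mu (a - i) (r - a - i)) K a i p *: W (iseq_of_part p.2).
Proof.
move=> cfE K0E KE mu_part.
have WE l : W (iseq_of_part l) = Vpart l.
  rewrite /W (sum_opmon_Bprod v_0 v_lt0 v_gen h_0 h_1 h_SS sh_is cfE (n := size l)).
    rewrite /Vpart; congr Bprod; apply: (@eq_from_nth _ 0).
      by rewrite !size_map size_iota.
    move=> i; rewrite size_map size_iota => lti.
    by rewrite (nth_map 0%N) ?size_iota // nth_iota // iseq_of_part_coef (nth_map 0%N).
  by move=> k lek; rewrite iseq_of_part_coef nth_default.
rewrite WE mulrC v_Vpart // -big_split; apply: eq_bigr => a _ /=.
rewrite big_ord_recl; congr (_ + _).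
  rewrite !subn0; apply: eq_fsbigr => p _.
  by rewrite h_0 mul1r WE K0E.
rewrite big_add1 /= big_mkord; apply: eq_bigr => i _; apply: eq_fsbigr => p _.
by rewrite WE KE.
Qed.

End Pieri.

Section StripPolyC.
Variables (K : comNzRingType) (t : K) (l n : seq nat).

Lemma strip_col1_le i : strip_col l n i = 1 -> (i <= sumn l)%N.
Proof.
rewrite leqNgt => col1; apply/negP => lti; move: col1.
by rewrite /strip_col (conj_gt (leq_sumn l) lti); case: (conj_part n i).
Qed.

Lemma strip_phi_polyC : (strip_phi t l n)%:P = strip_phi t%:P l n.
Proof.
have mem_I i : strip_I l n i -> i \in iota 0 (sumn l).+1.
  by case=> _ /strip_col1_le lei _; rewrite mem_iota.
rewrite /strip_phi !(fsbig_sub _ (r := iota 0 (sumn l).+1)) ?iota_uniq // rmorph_prod.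
by apply: eq_bigr => i _; rewrite /= polyCB polyC_exp.
Qed.

Lemma strip_psi_polyC : (strip_psi t l n)%:P = strip_psi t%:P l n.
Proof.
have mem_J i : strip_J l n i -> i \in iota 0 (sumn l).+1.
  by case=> _ _ /strip_col1_le /ltnW lei; rewrite mem_iota.
rewrite /strip_psi !(fsbig_sub _ (r := iota 0 (sumn l).+1)) ?iota_uniq // rmorph_prod.
by apply: eq_bigr => i _; rewrite /= polyCB polyC_exp.
Qed.

End StripPolyC.

Lemma v_0 : v 0 = 1.
Proof. by []. Qed.

Lemma phi_polyC l n : (phi l n)%:P = strip_phi t%:P l n.
Proof. exact: strip_phi_polyC. Qed.

Lemma psi_polyC l n : (psi l n)%:P = strip_psi t%:P l n.
Proof. exact: strip_psi_polyC. Qed.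

Lemma geom_coefE i : (0 < i)%N -> geom_coef i = t ^+ i - t ^+ i.-1.
Proof.
case: i => // i _; rewrite /geom_coef /= mulrBl mul1r exprS mulKf //.
exact: t_neq0.
Qed.

Lemma weight_polyC (K : comNzRingType) (x : {poly K}) (a b c : K) :
  x * (a * (b * c))%:P = x * (a%:P * (b%:P * c%:P)).
Proof. by rewrite !polyCM. Qed.

Theorem theoremA (r : nat) (r_ge1 : (1 <= r)%N)
    (mu : seq nat) (mu_part : is_part mu) :
  Vi (iseq_of_part mu) * v r%:Z =
    \sum_(a < r.+1)
      \sum_(p \in updown mu a (r - a))
        (theta ^+ a * (phi p.1 p.2 * psi p.1 mu)%:P) *: Vi (iseq_of_part p.2)
  + \sum_(a < r.+1)
      \sum_(1 <= i < (minn a (r - a)).+1)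
        \sum_(p \in updown mu (a - i) (r - a - i))
          (theta ^+ a * ((t ^+ i - t ^+ i.-1) * (phi p.1 p.2 * psi p.1 mu))%:P)
            *: Vi (iseq_of_part p.2).
Proof.
apply: (opmon_pieri v_0 v_lt0 v_generates Lambda_char acoef0 acoef1 acoefSS
  hcoef0 hcoef1 hcoefSS sa_is_shift sh_is_shift
  (cf := fun d => lower_coef d.1 * raise_coef d.2)
  (K0 := fun a p => theta ^+ a * (phi p.1 p.2 * psi p.1 mu)%:P)
  (K := fun a i p => theta ^+ a *
     ((t ^+ i - t ^+ i.-1) * (phi p.1 p.2 * psi p.1 mu))%:P)).
- exact: coef_opsupp.
- by move=> a p; rewrite polyCM phi_polyC psi_polyC.
- move=> a i p i_gt0; rewrite weight_polyC phi_polyC psi_polyC.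
  by rewrite -geom_coefE.
exact: mu_part.
Qed.
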